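(* For arbitrary (deterministic) regression coefficients $\boldsymbol\beta$ with sparsity $k$ satisfying $k\le\epsilon p$, the rank $T$ of the first false variable selected by the Lasso satisfies $$T\le(1+o_{\mathbb P}(1))\frac{n}{2\log p}$$ as $n,p\to\infty$, where $o_{\mathbb P}(1)$ denotes a quantity tending to $0$ in probability.
   Context: Model. $\boldsymbol y=\boldsymbol X\boldsymbol\beta+\boldsymbol z$ with $\boldsymbol X\in\mathbb R^{n\times p}$. Along a sequence of problems, $n,p\to\infty$ with $n/p\to\delta$ for a constant $\delta>0$; $\boldsymbol X$ has i.i.d. $\mathcal N(0,1/n)$ entries; $\boldsymbol z$ has i.i.d. $\mathcal N(0,\sigma^2)$ entries with $\sigma\ge0$ fixed; $\boldsymbol X$ and $\boldsymbol z$ are independent; $\boldsymbol\beta\in\mathbb R^p$ is deterministic (it may vary with the index of the sequence). The sparsity is $k=\#\{j:\beta_j\ne0\}$, and $0<\epsilon<1$ is a fixed constant. Lasso. For $\lambda>0$, $\widehat{\boldsymbol\beta}(\lambda)=\arg\min_{\boldsymbol b\in\mathbb R^p}\frac12\|\boldsymbol y-\boldsymbol X\boldsymbol b\|^2+\lambda\|\boldsymbol b\|_1$. Rank of the first false variable. Let $$\lambda^\ast=\sup\{\lambda:\text{there exists }1\le i\le p\text{ with }\widehat\beta_i(\lambda)\ne0,\ \beta_i=0\}$$ be the first time (as $\lambda$ decreases from $\infty$) that a false variable is about to be selected. Then $$T:=\#\{j:\widehat\beta_j(\lambda^\ast-0)\ne0\}=\#\{j:\widehat\beta_j(\lambda^\ast)\ne0\}+1,$$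 where $\lambda^\ast-0$ denotes a value infinitesimally smaller than $\lambda^\ast$; i.e. $T$ is one plus the number of true variables selected just before the first false variable. *)

(* Defs.v *)
From HB Require Import structures.
From mathcomp Require Import all_boot all_order all_algebra.
From mathcomp Require Import all_classical all_reals all_analysis.

Set Implicit Arguments.
Unset Strict Implicit.
Unset Printing Implicit Defensive.

Import Order.TTheory GRing.Theory Num.Theory.
Import numFieldNormedType.Exports.

Local Open Scope classical_set_scope.
Local Open Scope ring_scope.

Section lasso.
Variables (R : realType) (n p : nat).
Implicit Types (X : 'M[R]_(n, p)) (y : 'cV[R]_n) (b beta : 'cV[R]_p).

Definition lasso_objective X y (lambda : R) b : R :=
  2^-1 * (\sum_(i < n) (y i 0 - (X *m b) i 0) ^+ 2)
  + lambda * \sum_(j < p) `|b j 0|.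

Definition lasso_argmin X y (lambda : R) : set 'cV[R]_p :=
  [set b | forall b', lasso_objective X y lambda b <= lasso_objective X y lambda b'].

(* For lambda > 0 a minimizer always exists; for a Gaussian design it is almost
   surely unique, so the choice made here only matters on a null event. *)
Definition lasso X y (lambda : R) : 'cV[R]_p :=
  xget 0 (lasso_argmin X y lambda).

Definition support_size b : nat := #|[set j | b j 0 != 0]|.

Definition false_selection X y beta : set R :=
  [set lambda | 0 < lambda /\
    exists i : 'I_p, lasso X y lambda i 0 != 0 /\ beta i 0 = 0].

(* [false_selection] is bounded above, by the largest absolute correlation
   of y with a column of X, so that [sup] is a genuine supremum as soon as the
   set is nonempty. *)
Definition lambda_star X y beta : R := sup (false_selection X y beta).

(* The limits are taken in the discrete space nat: the number of selected
   variables is eventually constant when lambda approaches its limit.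
   If no false variable is ever selected (e.g., when y = 0), lambda_star is not
   meaningful and the first false variable is understood to come right after
   the (true) variables selected at the end of the path, i.e., when lambda
   decreases to 0. *)
Definition first_false_rank X y beta : nat :=
  if `[< false_selection X y beta !=set0 >] then
    lim (support_size (lasso X y l) @[l --> (lambda_star X y beta)^'-])
  else
    (lim (support_size (lasso X y l) @[l --> (0 : R)^'+])).+1.

End lasso.

Section probability.
Variables (d : measure_display) (Omega : measurableType d) (R : realType).
Variable P : probability Omega R.

Definition mutually_independent (I : finType) (V : I -> {RV P >-> R}) : Prop :=
  forall (J : {set I}) (B : I -> set R), (forall i, measurable (B i)) ->
    P (\bigcap_(i in [set` J]) (V i @^-1` B i)) =
    (\prod_(i in J) P (V i @^-1` B i))%E.

(* N(0, s^2). The library's [normal_prob 0 s] is not the point mass at 0 when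
   s = 0. *)
Definition has_centered_gaussian_law (V : {RV P >-> R}) (s : R) : Prop :=
  forall A : set R, measurable A ->
    distribution P V A = if s == 0 then \d_(0 : R) A else normal_prob 0 s A.

Definition linear_model_entries (n p : nat)
    (X : 'I_n -> 'I_p -> {RV P >-> R}) (z : 'I_n -> {RV P >-> R})
    (t : 'I_n * 'I_p + 'I_n) : {RV P >-> R} :=
  match t with inl ij => X ij.1 ij.2 | inr i => z i end.

(* Mutual independence of all the entries of X and z taken together expresses
   that the entries of X are independent, those of z are independent, and X is
   independent of z. *)
Definition gaussian_linear_model (n p : nat) (sigma : R)
    (X : 'I_n -> 'I_p -> {RV P >-> R}) (z : 'I_n -> {RV P >-> R}) : Prop :=
  [/\ forall i j, has_centered_gaussian_law (X i j) (Num.sqrt (n%:R^-1)),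
      forall i, has_centered_gaussian_law (z i) sigma
    & mutually_independent (linear_model_entries X z)].

Definition design (n p : nat) (X : 'I_n -> 'I_p -> {RV P >-> R})
    (w : Omega) : 'M[R]_(n, p) := \matrix_(i, j) X i j w.

Definition response (n p : nat) (X : 'I_n -> 'I_p -> {RV P >-> R})
    (z : 'I_n -> {RV P >-> R}) (beta : 'cV[R]_p) (w : Omega) : 'cV[R]_n :=
  design X w *m beta + \col_i z i w.

End probability.

Definition vanishes_in_probability (R : realType) (d : nat -> measure_display)
    (Omega : forall m, measurableType (d m))
    (P : forall m, probability (Omega m) R)
    (r : forall m, {RV (P m) >-> R}) : Prop :=
  forall eta : R, 0 < eta ->
    P m [set w | eta <= `|r m w|] @[m --> \oo] --> 0%E.

(* Main.v *)
Require Import Defs.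
From HB Require Import structures.
From mathcomp Require Import all_boot all_order all_algebra.
From mathcomp Require Import all_classical all_reals all_analysis.
From mathcomp Require Import measurable_realfun ring lra.

Set Implicit Arguments.
Unset Strict Implicit.
Unset Printing Implicit Defensive.

Import Order.TTheory GRing.Theory Num.Theory.
Import numFieldNormedType.Exports.

Local Open Scope classical_set_scope.
Local Open Scope ring_scope.

(** The path of the Lasso is parametrized by the inverse time t = 1 / lambda and
    described by the scaled residual u(t) = (y - X b) / lambda. It is the
    residual of the Lasso with penalty 1 and response t y, that is, the
    projection of t y on the vectors with correlations of size at most 1 with
    all the columns; so it is unique and Lipschitz in t
    ([residual_nonexpansive], [dot_residual_lipschitz]). A variable is selected
    only when its column is touched, meaning that the correlation of the column
    with u(t) is 1 or -1. Until a false variable is selected, u(t) is the path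
    of the Lasso on the true columns, which is a function of the true columns
    and of the noise and is therefore independent of the false columns.

    Let s be slightly above n / (2 log p) and suppose that the first false
    variable has a rank above s. By [late_first_false], more than s columns are
    touched at the time of the first false selection, and no false column has
    had a correlation above 1 before. Almost surely at most one of the touched
    columns is false, because two false columns are never touched
    simultaneously ([tie_negligible]). So s true columns have been touched
    early, and this is improbable for two reasons.

    First, touching s columns makes the residual large: pairing u(t) with the
    sum of these columns, each with the sign of its correlation, gives s, so
    that |u(t)|^2 >= s / (1 + eta) as soon as all signed sums of s columns have
    a squared norm of at most (1 + eta) s ([touching_norm]). The latter holds
    with high probability by a union bound over the C(p, s) 2^s signed sums and
    the exponential tail of the chi-square law: as s is of order n / log p, the
    logarithm of the number of sums is o(n) ([large_signed_sum_le],
    [selection_entropy_le]).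

    Secondly, at the first time at which s true columns are touched, u(t) is
    independent of the false columns, whose correlations with it are
    independent normal variables of variance |u(t)|^2 / n, that is, more than
    1 / (2 log p) by a constant factor. The maximum of at least (1 - eps) p of
    them exceeds 1 with probability tending to 1 ([early_touch_le],
    [tail_weight_rate]). Working at this one random time gives an estimate that
    is uniform in the true coefficients.

    The measure theory rests on three devices. Independence is used through
    the sigma-algebras generated by blocks of entries of the model, for which
    the pair made of the same sample point seen in two disjoint blocks has a
    product law ([distribution_block_diagonal], [section_bound]). The residual
    is measurable because it is the gradient of the optimal value
    ([residual_coord_limit]). First passages are detected at rational times
    ([rational_passage_zero]). *)

(** * Euclidean inner product on column vectors *)

Section euclid.
Variables (R : realType) (n : nat).
Implicit Types u v w : 'cV[R]_n.

Definition dot u v : R := \sum_(i < n) u i 0 * v i 0.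

Lemma dotC u v : dot u v = dot v u.
Proof. by apply: eq_bigr => i _; rewrite mulrC. Qed.

Lemma dotDl u v w : dot (u + v) w = dot u w + dot v w.
Proof. by rewrite -big_split; apply: eq_bigr => i _; rewrite mxE mulrDl. Qed.

Lemma dotDr u v w : dot w (u + v) = dot w u + dot w v.
Proof. by rewrite !(dotC w) dotDl. Qed.

Lemma dotZl a u v : dot (a *: u) v = a * dot u v.
Proof. by rewrite mulr_sumr; apply: eq_bigr => i _; rewrite mxE mulrA. Qed.

Lemma dotZr a u v : dot u (a *: v) = a * dot u v.
Proof. by rewrite !(dotC u) dotZl. Qed.

Lemma dotNl u v : dot (- u) v = - dot u v.
Proof. by rewrite -scaleN1r dotZl mulN1r. Qed.

Lemma dotNr u v : dot u (- v) = - dot u v.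
Proof. by rewrite !(dotC u) dotNl. Qed.

Lemma dot0l u : dot 0 u = 0.
Proof. by rewrite -(scale0r u) dotZl mul0r. Qed.

Lemma dot_ge0 u : 0 <= dot u u.
Proof. by apply: sumr_ge0 => i _; rewrite -expr2 sqr_ge0. Qed.

Lemma dot_eq0 u : dot u u = 0 -> u = 0.
Proof.
move=> /eqP; rewrite psumr_eq0; last by move=> i _; rewrite -expr2 sqr_ge0.
move=> /allP u0; apply/colP => i; rewrite mxE.
by have := u0 i (mem_index_enum i); rewrite -expr2 sqrf_eq0 => /eqP.
Qed.

Lemma CauchySchwarz_dot u v : dot u v ^+ 2 <= dot u u * dot v v.
Proof.
have [v0|v0] := eqVneq (dot v v) 0.
  by rewrite (dot_eq0 v0) dotC dot0l expr0n/= dot0l mulr0.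
have vv : 0 < dot v v by rewrite lt_def v0 dot_ge0.
have := dot_ge0 (dot v v *: u - dot u v *: v).
rewrite !(dotDl, dotDr, dotNl, dotNr, dotZl, dotZr) (dotC v u).
set a := dot u u; set b := dot u v; set c := dot v v => h.
have : 0 <= c * (a * c - b ^+ 2) by rewrite (le_trans h)//; lra.
by rewrite pmulr_rge0// subr_ge0.
Qed.

End euclid.

Notation sqn u := (dot u u).

Definition dotE := (dotDl, dotDr, dotNl, dotNr, dotZl, dotZr).

Lemma dot_mulmx (R : realType) (n p : nat) (X : 'M[R]_(n, p)) (u : 'cV[R]_n)
  (b : 'cV[R]_p) : dot u (X *m b) = \sum_(j < p) (X^T *m u) j 0 * b j 0.
Proof.
rewrite /dot; under eq_bigr do rewrite mxE mulr_sumr.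
rewrite exchange_big/=; apply: eq_bigr => j _.
rewrite mxE mulr_suml; apply: eq_bigr => i _.
by rewrite mxE mulrA (mulrC (u i 0)).
Qed.

(** * Optimality and stability of the Lasso *)

Section lasso_theory.
Variables (R : realType) (n p : nat).
Implicit Types (X : 'M[R]_(n, p)) (y : 'cV[R]_n) (b c : 'cV[R]_p).

Definition l1norm b : R := \sum_(j < p) `|b j 0|.

Lemma l1norm_ge0 b : 0 <= l1norm b.
Proof. exact: sumr_ge0. Qed.

Lemma l1norm_convex b c (t : R) : 0 <= t -> t <= 1 ->
  l1norm (b + t *: (c - b)) <= (1 - t) * l1norm b + t * l1norm c.
Proof.
move=> t0 t1; rewrite !mulr_sumr -big_split/=; apply: ler_sum => j _.
rewrite !mxE.
have -> : b j 0 + t * (c j 0 - b j 0) = (1 - t) * b j 0 + t * c j 0 by ring.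
rewrite (le_trans (ler_normD _ _))// !normrM (ger0_norm t0) ger0_norm//.
by rewrite subr_ge0.
Qed.

Lemma lasso_objectiveE X y (lambda : R) b :
  lasso_objective X y lambda b =
  2^-1 * dot (y - X *m b) (y - X *m b) + lambda * l1norm b.
Proof.
congr (_ * _ + _); apply: eq_bigr => i _.
by rewrite !mxE -expr2.
Qed.

(** The objective is a quadratic form in the fit plus a multiple of the l1
    norm, so its increments are exact: only a nonnegative quadratic term
    separates them from the subgradient inequality. *)
Lemma lasso_objective_expand X y (lambda : R) b c :
  lasso_objective X y lambda c = lasso_objective X y lambda b
    + 2^-1 * dot (X *m (c - b)) (X *m (c - b))
    - dot (y - X *m b) (X *m (c - b)) + lambda * (l1norm c - l1norm b).
Proof.
rewrite !lasso_objectiveE.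
have -> : y - X *m c = (y - X *m b) - X *m (c - b).
  by rewrite mulmxBr opprB addrA subrK.
move: (y - X *m b) (X *m (c - b)) => u v; rewrite !dotE (dotC v u); lra.
Qed.

(** First-order optimality. The forward direction compares b with the points
    b + t (c - b): the l1 norm is convex and the quadratic term is of order
    t ^ 2, so that it disappears after division by t as t tends to 0. *)
Lemma lasso_argminP X y (lambda : R) b : 0 <= lambda ->
  lasso_argmin X y lambda b <->
  forall c, dot (y - X *m b) (X *m (c - b)) <= lambda * (l1norm c - l1norm b).
Proof.
move=> l0; split=> [bmin c|bvar c]; last first.
  rewrite (lasso_objective_expand X y lambda b c).
  have := bvar c; have := dot_ge0 (X *m (c - b)); lra.
have [u uE] : exists u, u = y - X *m b by exists (y - X *m b).
rewrite -uE.
set v := X *m (c - b).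
apply/ler_addgt0Pr => /= e e0.
have v0 : 0 <= dot v v := dot_ge0 v.
(* This t makes the quadratic error t |v|^2 at most e. *)
pose t := Num.min 1 (e / (dot v v + 1)).
have t0 : 0 < t by rewrite lt_min ltr01/= divr_gt0// ltr_wpDl.
have t1 : t <= 1 by rewrite ge_min lexx.
have te : t * dot v v <= e.
  have : t <= e / (dot v v + 1) by rewrite ge_min lexx orbT.
  rewrite ler_pdivlMr ?ltr_wpDl// => h; apply: le_trans h.
  by rewrite ler_wpM2l ?(ltW t0)// lerDl.
have := bmin (b + t *: (c - b)).
rewrite (lasso_objective_expand X y lambda b (b + _)).
rewrite -uE [b + _ - b]addrC addKr -scalemxAr -/v !dotE.
clearbody t v.
have := l1norm_convex b c (ltW t0) t1 => h1 h2.
have h3 : lambda * (l1norm (b + t *: (c - b)) - l1norm b)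
    <= t * (lambda * (l1norm c - l1norm b)).
  rewrite mulrCA ler_wpM2l//. lra.
have h4 : t * dot u v <=
    t * (2^-1 * (t * dot v v) + lambda * (l1norm c - l1norm b)) by lra.
rewrite ler_pM2l// in h4.
have : 0 <= t * dot v v by rewrite mulr_ge0// ltW.
by move: h4 te; lra.
Qed.

Lemma lasso_objective_continuous X y (lambda : R) :
  continuous (fun v : 'rV[R]_p => lasso_objective X y lambda v^T).
Proof.
have sumc (I : finType) (h : I -> 'rV[R]_p -> R) :
    (forall i, continuous (h i)) -> continuous (fun v => \sum_(i : I) h i v).
  by move=> hc v; have FF := @nbhs_filter _ v; apply: (cvg_big add_continuous) => i _; exact: hc.
have coordc j : continuous (fun v : 'rV[R]_p => v^T j 0).
  rewrite (_ : (fun v => _) = (fun v : 'rV[R]_p => v 0 j)).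
    exact: coord_continuous.
  by apply/funext => v; rewrite mxE.
have termc i : continuous (fun v : 'rV[R]_p => y i 0 - (X *m v^T) i 0).
  rewrite (_ : (fun v => _) =
      (fun v : 'rV[R]_p => y i 0 - \sum_j X i j * v^T j 0)); last first.
    by apply/funext => w; rewrite mxE.
  move=> v; apply: continuousB; first exact: cst_continuous.
  apply: sumc => j {}v; apply: continuousM; first exact: cst_continuous.
  exact: coordc.
have sqc i : continuous (fun v : 'rV[R]_p => (y i 0 - (X *m v^T) i 0) ^+ 2).
  rewrite (_ : (fun v => _) = (fun v : 'rV[R]_p =>
      (y i 0 - (X *m v^T) i 0) * (y i 0 - (X *m v^T) i 0))).
    by move=> v; exact: (continuousM (termc i v) (termc i v)).
  by apply/funext => w; rewrite expr2.
have absc j : continuous (fun v : 'rV[R]_p => `|v^T j 0|).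
  by move=> v; exact: (cvg_comp _ _ (coordc j v) (@norm_continuous _ R^o _)).
rewrite /lasso_objective => v.
apply: (@continuousD _ _ _
  (fun v => 2^-1 * \sum_(i < n) (y i 0 - (X *m v^T) i 0) ^+ 2)
  (fun v => lambda * \sum_(j < p) `|v^T j 0|)).
  by apply: continuousM; [exact: cst_continuous|exact: sumc].
by apply: continuousM; [exact: cst_continuous|exact: sumc].
Qed.

(** Outside the cube of half-width f 0 / lambda the penalty alone exceeds the
    objective at 0, so a minimizer over this compact cube is global. *)
Lemma lasso_exists X y (lambda : R) : 0 < lambda ->
  exists b, lasso_argmin X y lambda b.
Proof.
move=> l0; pose f (v : 'rV[R]_p) := lasso_objective X y lambda v^T.
pose M := f 0 / lambda.
have f0 v : 0 <= f v.
  by rewrite /f lasso_objectiveE addr_ge0// mulr_ge0 ?dot_ge0 ?l1norm_ge0 ?ltW.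
have M0 : 0 <= M by rewrite divr_ge0// ltW.
pose A := [set v : 'rV[R]_p | forall j, `[- M, M]%classic (v ord0 j)].
have cf : continuous f := @lasso_objective_continuous X y lambda.
have A0 : A 0 by move=> j; rewrite /= in_itv/= mxE oppr_le0 M0.
have cA : compact A.
  apply: (@rV_compact R p (fun=> `[- M, M]%classic)) => j.
  exact: segment_compact.
have [c _ cmin] := EVT_min_rV (ex_intro _ 0 A0) cA (continuous_subspaceT cf).
exists c^T => b'; have [b'A|b'A] := pselect (A b'^T).
  by have := cmin _ (mem_set b'A); rewrite /f trmxK.
have : f c <= f 0.
  by apply: cmin; exact: mem_set.
move=> h; apply: (le_trans h).
have [j hj] : exists j, M < `|b' j 0|.
  apply: contrapT => nh; apply: b'A => j; rewrite /= in_itv/= -ler_norml.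
  by rewrite leNgt mxE; apply/negP => hj; apply: nh; exists j.
rewrite -(divfK (lt0r_neq0 l0) (f 0)) -/M mulrC lasso_objectiveE.
rewrite ler_wpDl ?mulr_ge0 ?dot_ge0// ler_pM2l// (le_trans (ltW hj))//.
by rewrite /l1norm (bigD1 j)//= lerDl sumr_ge0.
Qed.

Lemma lassoP X y (lambda : R) : 0 < lambda ->
  lasso_argmin X y lambda (lasso X y lambda).
Proof.
move=> l0; have [b hb] := lasso_exists X y l0.
exact: (xgetPex 0 (ex_intro _ b hb)).
Qed.

(** The residual is the projection of y on the convex set of the vectors u
    with |X_j^T u| <= lambda for all j, hence 1-Lipschitz in y: add the
    variational inequalities of the two solutions. *)
Lemma lasso_residual_nonexpansive X y y' (lambda : R) b b' : 0 <= lambda ->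
  lasso_argmin X y lambda b -> lasso_argmin X y' lambda b' ->
  sqn (y - X *m b - (y' - X *m b')) <= sqn (y - y').
Proof.
move=> l0 hb hb'; set e := y - X *m b - (y' - X *m b').
have h := (lasso_argminP _ _ _ l0).1 hb b'.
have h' := (lasso_argminP _ _ _ l0).1 hb' b.
rewrite !mulmxBr in h h'.
have h2 : dot e (X *m b' - X *m b) <= 0.
  by move: h h'; rewrite /e !dotE; lra.
have h3 : X *m b' - X *m b = e - (y - y').
  by rewrite /e; apply/colP => i; rewrite !mxE; ring.
have h4 := dot_ge0 (e - (y - y')).
move: h2 h4; rewrite h3; move: (y - y') e {h3} => f e.
by rewrite !dotE (dotC f e); lra.
Qed.

Lemma lasso_residual_unique X y (lambda : R) b b' : 0 <= lambda ->
  lasso_argmin X y lambda b -> lasso_argmin X y lambda b' ->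
  y - X *m b = y - X *m b'.
Proof.
move=> l0 hb hb'.
have := lasso_residual_nonexpansive l0 hb hb'; rewrite subrr dot0l => h.
apply/eqP; rewrite -subr_eq0; apply/eqP/dot_eq0/eqP.
by rewrite eq_le h dot_ge0.
Qed.

(** The variational inequality along the coordinate direction j. *)
Lemma lasso_kkt X y (lambda : R) b j (h : R) : 0 <= lambda ->
  lasso_argmin X y lambda b ->
  h * (X^T *m (y - X *m b)) j 0 <= lambda * (`|b j 0 + h| - `|b j 0|).
Proof.
move=> l0 hb.
have := (lasso_argminP _ _ _ l0).1 hb (b + h *: delta_mx j 0).
rewrite [b + _ - b]addrC addKr dot_mulmx (bigD1 j)//= big1 ?addr0; last first.
  by move=> i ij; rewrite !mxE (negbTE ij)/= !mulr0.
rewrite !mxE !eqxx/= mulr1 => H.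
rewrite mulrC (le_trans H)// ler_wpM2l//.
rewrite /l1norm (bigD1 j)//= [X in _ - X](bigD1 j)//= !mxE !eqxx/= mulr1.
rewrite opprD addrACA [X in _ + X](_ : _ = 0) ?addr0//.
apply/eqP; rewrite subr_eq0; apply/eqP/eq_bigr => i ij.
by rewrite !mxE (negbTE ij)/= mulr0 addr0.
Qed.

Lemma lasso_correlation_le X y (lambda : R) b j : 0 <= lambda ->
  lasso_argmin X y lambda b -> `|(X^T *m (y - X *m b)) j 0| <= lambda.
Proof.
move=> l0 hb; set x := (X^T *m (y - X *m b)) j 0.
have h1 : forall h, h * x <= lambda * `|h|.
  move=> h; have := lasso_kkt j h l0 hb; rewrite -/x => /le_trans; apply.
  by rewrite ler_wpM2l// lerBlDl ler_normD.
have := h1 1; have := h1 (-1); rewrite normrN normr1 ler_norml => ? ?.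
by apply/andP; split; lra.
Qed.

(** Moving b_j to 0 must not pay, which forces the reverse inequality. *)
Lemma lasso_correlation_eq X y (lambda : R) b j : 0 <= lambda ->
  lasso_argmin X y lambda b -> b j 0 != 0 ->
  `|(X^T *m (y - X *m b)) j 0| = lambda.
Proof.
move=> l0 hb bj; apply/eqP; rewrite eq_le lasso_correlation_le//=.
have := lasso_kkt j (- b j 0) l0 hb; rewrite subrr normr0 sub0r mulNr mulrN lerN2.
set x := (X^T *m (y - X *m b)) j 0 => h.
have : lambda * `|b j 0| <= `|x| * `|b j 0|.
  by rewrite (le_trans h)// [leRHS]mulrC -normrM ler_norm.
by rewrite ler_pM2r// normr_gt0.
Qed.

Lemma lasso_argmin_scale X y (lambda : R) b : 0 < lambda ->
  lasso_argmin X y lambda b -> lasso_argmin X (lambda^-1 *: y) 1 (lambda^-1 *: b).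
Proof.
move=> l0 hb c.
have E b' : lasso_objective X (lambda^-1 *: y) 1 (lambda^-1 *: b') =
    lambda^-2 * lasso_objective X y lambda b'.
  rewrite !lasso_objectiveE -scalemxAr -scalerBr !dotE.
  have -> : l1norm (lambda^-1 *: b') = lambda^-1 * l1norm b'.
    rewrite /l1norm mulr_sumr; apply: eq_bigr => j _.
    by rewrite mxE normrM ger0_norm// invr_ge0 ltW.
  by field; exact: lt0r_neq0.
have -> : c = lambda^-1 *: (lambda *: c).
  by rewrite scalerA mulVf ?scale1r// lt0r_neq0.
by rewrite !E ler_wpM2l// invr_ge0 exprn_ge0// ltW.
Qed.

(** The Lasso is normalized to lambda = 1: by [residualE] the whole path is
    recovered from the responses t *: y, where t = 1 / lambda. *)
Definition residual X y : 'cV[R]_n := y - X *m lasso X y 1.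

Lemma residualE X y (lambda : R) b : 0 < lambda -> lasso_argmin X y lambda b ->
  residual X (lambda^-1 *: y) = lambda^-1 *: (y - X *m b).
Proof.
move=> l0 hb; rewrite scalerBr scalemxAr.
apply: (@lasso_residual_unique X _ 1) => //; first exact: lassoP.
exact: lasso_argmin_scale.
Qed.

Lemma residual_nonexpansive X y y' :
  sqn (residual X y - residual X y') <= sqn (y - y').
Proof. by apply: (@lasso_residual_nonexpansive X y y' 1) => //; exact: lassoP. Qed.

Lemma residual_correlation_le X y j : `|(X^T *m residual X y) j 0| <= 1.
Proof. by apply: lasso_correlation_le => //; exact: lassoP. Qed.

(** Erasing the columns outside S instead of deleting them keeps the dimensions
    fixed, and the erased coordinates of a minimizer are irrelevant to the
    fitted values. *)
Definition mask_columns (S : {set 'I_p}) X : 'M[R]_(n, p) :=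
  \matrix_(i, j) (if j \in S then X i j else 0).

Lemma mask_columns_mulmx (S : {set 'I_p}) X b :
  (forall j, j \notin S -> b j 0 = 0) -> mask_columns S X *m b = X *m b.
Proof.
move=> bS; apply/colP => i; rewrite !mxE; apply: eq_bigr => j _.
by rewrite mxE; case: ifPn => // /bS ->; rewrite !mulr0.
Qed.

(** A solution that ignores the columns outside S also solves the problem from
    which these columns are erased: a competitor can be restricted to S without
    changing its fit and without increasing its penalty. *)
Lemma lasso_argmin_mask (S : {set 'I_p}) X y (lambda : R) b : 0 <= lambda ->
  (forall j, j \notin S -> b j 0 = 0) ->
  lasso_argmin X y lambda b -> lasso_argmin (mask_columns S X) y lambda b.
Proof.
move=> l0 bS hb c.
pose c' : 'cV[R]_p := \col_j (if j \in S then c j 0 else 0).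
have Ec : mask_columns S X *m c = X *m c'.
  apply/colP => i; rewrite !mxE; apply: eq_bigr => j _.
  by rewrite !mxE; case: ifP => //; rewrite mul0r mulr0.
have := hb c'; rewrite !lasso_objectiveE mask_columns_mulmx// Ec => /le_trans; apply.
rewrite lerD2l ler_wpM2l//; apply: ler_sum => j _; rewrite mxE.
by case: ifP; rewrite ?normr0.
Qed.

End lasso_theory.

(** * The residual path and the first false selection *)

Section lasso_path.
Variables (R : realType) (n p : nat).
Implicit Types (X : 'M[R]_(n, p)) (y : 'cV[R]_n) (beta : 'cV[R]_p).

Lemma trmx_mulmx_col X (u : 'cV[R]_n) j : (X^T *m u) j 0 = dot (col j X) u.
Proof. by rewrite mxE; apply: eq_bigr => i _; rewrite !mxE. Qed.

(** Nonexpansiveness in the response, applied to the responses s *: y and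
    t *: y. *)
Lemma dot_residual_lipschitz X y (a : 'cV[R]_n) (s t : R) :
  `|dot a (residual X (s *: y)) - dot a (residual X (t *: y))|
    <= Num.sqrt (sqn a * sqn y) * `|s - t|.
Proof.
rewrite -(ger0_norm (sqrtr_ge0 _)) -normrM -dotNr -dotDr.
rewrite -ler_sqr ?nnegrE// -!normrX !ger0_norm ?sqr_ge0//.
rewrite exprMn sqr_sqrtr ?mulr_ge0 ?dot_ge0//.
apply: (le_trans (CauchySchwarz_dot _ _)).
rewrite -mulrA ler_wpM2l ?dot_ge0//.
apply: (le_trans (residual_nonexpansive _ _ _)).
by rewrite -scalerBl !dotE expr2; lra.
Qed.

Lemma continuous_dot_residual X y (a : 'cV[R]_n) :
  continuous (fun t : R => dot a (residual X (t *: y))).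
Proof.
move=> t; apply/cvgrPdist_le => /= e e0.
set K := Num.sqrt (sqn a * sqn y).
have K0 : 0 <= K := sqrtr_ge0 _.
have K1 : 0 < K + 1 by rewrite ltr_wpDl.
near=> s.
rewrite (le_trans (dot_residual_lipschitz _ _ _ _ _))// -/K.
have st : `|t - s| <= e / (K + 1).
  near: s; apply: cvgr_dist_le; first exact: cvg_id.
  by rewrite divr_gt0.
rewrite (le_trans (ler_wpM2l K0 st))// mulrCA ler_piMr ?(ltW e0)//.
by rewrite ler_pdivrMr// mul1r lerDl.
Unshelve. all: by end_near. Qed.

(** Comparing a solution with 0 bounds lambda times its l1 norm by its
    correlation with X^T y. This makes the set of false selections bounded, so
    that its supremum is meaningful. *)
Lemma lasso_neq0_lambda_le X y (lambda : R) j : 0 < lambda ->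
  lasso X y lambda j 0 != 0 -> lambda <= \sum_(i < p) `|(X^T *m y) i 0|.
Proof.
move=> l0 bj; set b := lasso X y lambda.
have b0 : 0 < l1norm b.
  rewrite /l1norm (bigD1 j)//= ltr_pwDl ?normr_gt0//.
  exact: sumr_ge0.
have hb : lasso_argmin X y lambda b by exact: lassoP.
have := (lasso_argminP _ _ _ (ltW l0)).1 hb 0.
rewrite sub0r mulmxN (_ : l1norm 0 = 0); last first.
  by rewrite /l1norm big1// => i _; rewrite mxE normr0.
rewrite !dotE sub0r mulrN => h.
have h1 : lambda * l1norm b <= dot y (X *m b).
  by have := dot_ge0 (X *m b); lra.
rewrite -(ler_pM2r b0) (le_trans h1)// dot_mulmx mulr_suml ler_sum// => i _.
rewrite (le_trans (ler_norm _))// normrM ler_wpM2l//.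
by rewrite /l1norm (bigD1 i)//= lerDl sumr_ge0.
Qed.

Lemma has_ubound_false_selection X y beta : has_ubound (false_selection X y beta).
Proof.
exists (\sum_(i < p) `|(X^T *m y) i 0|) => l [l0 [i [bi _]]].
exact: lasso_neq0_lambda_le bi.
Qed.

(** As long as no false variable is selected, the full Lasso and the Lasso on
    the true columns have the same residual; the latter does not depend on the
    false columns. *)
Lemma residual_mask_eq X y beta (lambda : R) : 0 < lambda ->
  ~ false_selection X y beta lambda ->
  residual (mask_columns [set j | beta j 0 != 0]%SET X) (lambda^-1 *: y) =
  residual X (lambda^-1 *: y).
Proof.
move=> l0 nfs.
have bS j : j \notin [set j | beta j 0 != 0]%SET -> lasso X y lambda j 0 = 0.
  rewrite inE negbK => /eqP bj; apply: contrapT => /eqP lj.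
  by apply: nfs; split => //; exists j.
have hb := lassoP X y l0.
rewrite (residualE l0 (lasso_argmin_mask (ltW l0) bS hb)) (residualE l0 hb).
by rewrite mask_columns_mulmx.
Qed.

Lemma lasso_selected_touches X y (lambda : R) j : 0 < lambda ->
  lasso X y lambda j 0 != 0 ->
  `|(X^T *m residual X (lambda^-1 *: y)) j 0| = 1.
Proof.
move=> l0 bj; have hb := lassoP X y l0.
rewrite (residualE l0 hb) -scalemxAr mxE normrM (lasso_correlation_eq (ltW l0) hb bj).
by rewrite ger0_norm ?invr_ge0 ?(ltW l0)// mulVf ?lt0r_neq0.
Qed.

Lemma support_sizeE (b : 'cV[R]_p) :
  support_size b = #|[set j | b j 0 != 0]%SET|.
Proof.
apply: eq_card => j; rewrite inE.
by apply/idP/idP => [/set_mem//|h]; exact/mem_set.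
Qed.

Lemma support_size_le (b : 'cV[R]_p) (A : {set 'I_p}) :
  (forall j, b j 0 != 0 -> j \in A) -> (support_size b <= #|A|)%N.
Proof.
move=> h; rewrite support_sizeE; apply: subset_leq_card; apply/fintype.subsetP => j.
by rewrite inE => /h.
Qed.

(** In the discrete space of natural numbers a limit is attained near the
    filter; without convergence the limit operator returns the default value
    0. *)
Lemma lim_nat_near (F : set_system R) (FF : ProperFilter F) (f : R -> nat) :
  (exists m, m = lim (f x @[x --> F]) /\ \forall x \near F, f x = m) \/
  lim (f x @[x --> F]) = 0%N.
Proof.
have [cf|ncf] := pselect (cvg (f x @[x --> F])); last by right; rewrite dvgP.
left; exists (lim (f x @[x --> F])); split => //.
have := cf [set lim (f x @[x --> F])]; apply.
exact: discrete_set1.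
Qed.

Lemma first_false_rank_le X y beta : (first_false_rank X y beta <= p.+1)%N.
Proof.
have key (F : set_system R) (FF : ProperFilter F) :
    (lim (support_size (lasso X y l) @[l --> F]) <= p)%N.
  have [[m [<- h]]|->//] := lim_nat_near FF (fun l => support_size (lasso X y l)).
  have [l <-] := filter_ex h.
  by rewrite (leq_trans (max_card _))// card_ord.
rewrite /first_false_rank; case: ifP => _; first exact: leqW (key _ _).
by rewrite ltnS; exact: key.
Qed.

(** The deterministic core. With tau the inverse of [lambda_star], the path u of
    the Lasso on the true columns agrees with the full path up to tau, by
    continuity also at tau; hence no false column exceeds 1 up to tau. All the
    variables selected just after tau are touched at tau, since an untouched
    column stays strictly below 1 near tau and a column below 1 is not
    selected. Thus at least as many columns are touched at tau as the rank of
    the first false variable. When no false variable is ever selected, one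
    column fewer is found, but all of them are true. *)
Lemma late_first_false X y beta (s : nat) (S := [set j | beta j 0 != 0]%SET)
    (u := fun t : R => residual (mask_columns S X) (t *: y)) :
  (s < first_false_rank X y beta)%N ->
  exists2 tau : R, 0 < tau &
    (forall t, 0 < t <= tau -> forall j, `|(X^T *m u t) j 0| <= 1) /\
    exists2 A : {set 'I_p}, forall j, j \in A -> `|(X^T *m u tau) j 0| = 1 &
      (s < #|A|)%N || ((A \subset S) && (s <= #|A|)%N).
Proof.
pose v t := residual X (t *: y).
have uv l : 0 < l -> ~ false_selection X y beta l -> u l^-1 = v l^-1.
  by move=> l0 h; rewrite /u residual_mask_eq.
rewrite /first_false_rank; case: asboolP => [fs0|fs0]; last first.
  (* Without a false selection the rank is one plus the limit of the support
     size at the end of the path: any small enough lambda is a witness. *)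
  have uv' t : 0 < t -> u t = v t.
    move=> t0; rewrite -(invrK t); apply: uv; rewrite ?invr_gt0// => h.
    by apply: fs0; exists t^-1.
  have le1 t j : 0 < t -> `|(X^T *m u t) j 0| <= 1.
    by move=> t0; rewrite uv'//; exact: residual_correlation_le.
  have [[m [<- h]]|->] := lim_nat_near (at_right_proper_filter (0 : R))
      (fun l => support_size (lasso X y l)); last first.
    rewrite ltnS leqn0 => /eqP ->; exists 1 => //; split.
      by move=> t /andP[t0 _] j; exact: le1.
    by exists finset.set0 => [j|]; rewrite ?inE// finset.sub0set orbT.
  rewrite ltnS => sm.
  have [l [lm l0]] : exists l, support_size (lasso X y l) = m /\ 0 < l.
    by apply: (@filter_ex _ _ (at_right_proper_filter (0 : R))); near=> l; split; near: l => //;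
      exact: nbhs_right_gt.
  exists l^-1; first by rewrite invr_gt0.
  split; first by move=> t /andP[t0 _] j; exact: le1.
  exists [set j | lasso X y l j 0 != 0]%SET.
    by move=> j; rewrite inE uv' ?invr_gt0//; exact: lasso_selected_touches.
  apply/orP; right; apply/andP; split; last by rewrite -support_sizeE lm.
  apply/fintype.subsetP => j; rewrite !inE => bj; apply/negP => /eqP betaj.
  by apply: fs0; exists l; split => //; exists j.
set ls := lambda_star X y beta => sT.
have ub := has_ubound_false_selection X y beta.
have ls0 : 0 < ls.
  have [l hl] := fs0; apply: (lt_le_trans hl.1).
  by apply: sup_upper_bound => //; split.
have ts0 : 0 < ls^-1 by rewrite invr_gt0.
have uvlt t : 0 < t -> t < ls^-1 -> u t = v t.
  move=> t0 tl; rewrite -(invrK t); apply: uv; rewrite ?invr_gt0// => h.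
  have : t^-1 <= ls by apply: sup_upper_bound => //; split.
  by rewrite leNgt; move/negP; apply; rewrite -(invrK ls) ltf_pV2 ?posrE.
(* The two paths agree to the left of the time 1 / lambda_star and are
   continuous there. *)
have uveq : u ls^-1 = v ls^-1.
  apply/colP => i; pose a : 'cV[R]_n := delta_mx i 0.
  have aE w : dot a w = w i 0.
    rewrite /dot (bigD1 i)//= big1 ?addr0 ?mxE ?eqxx ?mul1r// => k ki.
    by rewrite mxE (negbTE ki) mul0r.
  rewrite -!aE.
  have cu := cvg_at_left_filter (@continuous_dot_residual (mask_columns S X) y a ls^-1).
  have cv := cvg_at_left_filter (@continuous_dot_residual X y a ls^-1).
  suff cv' : dot a (u t) @[t --> ls^-1^'-] --> dot a (v ls^-1).
    by rewrite -(cvg_lim (@Rhausdorff R) cu) -(cvg_lim (@Rhausdorff R) cv').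
  apply: cvg_trans cv; apply: near_eq_cvg.
  have := nbhs_left_lt ls^-1; have := nbhs_left_gt ts0.
  by apply: filterS2 => t t0 tl; rewrite -/(v t) uvlt.
have uvle t : 0 < t <= ls^-1 -> u t = v t.
  move=> /andP[t0]; rewrite le_eqVlt => /orP[/eqP ->//|]; exact: uvlt.
exists ls^-1 => //; split.
  by move=> t ht j; rewrite uvle//; exact: residual_correlation_le.
pose A := [set j | `|(X^T *m v ls^-1) j 0| == 1]%SET.
exists A; first by move=> j; rewrite inE uveq => /eqP.
apply/orP; left.
have [[m [mE h]]|lim0] := lim_nat_near (at_left_proper_filter ls)
    (fun l => support_size (lasso X y l)); last by rewrite lim0 in sT.
rewrite -mE in sT; apply: (leq_trans sT).
have [l [lm lA]] : exists l, support_size (lasso X y l) = m /\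
    forall j, lasso X y l j 0 != 0 -> j \in A.
  apply: (@filter_ex _ _ (at_left_proper_filter ls)).
  apply: filterI => //.
  suff : \forall l \near ls^'-, forall j, 0 < l -> lasso X y l j 0 != 0 -> j \in A.
    by have := nbhs_left_gt ls0; apply: filterS2 => l l0 hl j; exact: hl.
  apply: filter_forall => j.
  have [jA|jA] := boolP (j \in A); first by near=> l.
  have c1 : `|(X^T *m v ls^-1) j 0| < 1.
    rewrite lt_neqAle residual_correlation_le andbT.
    by move: jA; rewrite inE.
  have cl : (fun l => `|(X^T *m v l^-1) j 0|) @ ls^'- --> `|(X^T *m v ls^-1) j 0|.
    apply: cvg_norm; rewrite trmx_mulmx_col.
    under eq_cvg do rewrite trmx_mulmx_col.
    apply: (@cvg_comp _ _ _ (fun l => l^-1) (fun t => dot (col j X) (v t))); last first.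
      exact: continuous_dot_residual.
    by apply: cvg_at_left_filter; apply: cvgV; rewrite ?gt_eqF//; exact: cvg_id.
  have cl1 : \forall l \near ls^'-, `|(X^T *m v l^-1) j 0| < 1.
    exact: (cvgr_lt _ cl _ c1).
  move: cl1; apply: filterS => l hl l0 bj.
  by move: hl; rewrite (lasso_selected_touches l0 bj) ltxx.
by rewrite -lm; exact: support_size_le.
Unshelve. all: by end_near. Qed.

End lasso_path.

(** * Measurability of the Lasso residual *)

Section measurable_comparison.
Context d (T : measurableType d) (R : realType).
Variables f g : T -> R.
Hypotheses (mf : measurable_fun setT f) (mg : measurable_fun setT g).

Lemma measurable_set_ltr : measurable [set w | f w < g w].
Proof.
rewrite -[X in measurable X]setTI.
rewrite (_ : [set w | _] = [set w | ((f w)%:E < (g w)%:E)%E])//.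
by apply: measurable_lte => //; exact/measurable_EFinP.
Qed.

Lemma measurable_set_ler : measurable [set w | f w <= g w].
Proof.
rewrite -[X in measurable X]setTI.
rewrite (_ : [set w | _] = [set w | ((f w)%:E <= (g w)%:E)%E])//.
by apply: measurable_lee => //; exact/measurable_EFinP.
Qed.

End measurable_comparison.

Section residual_measurability.
Variables (R : realType) (n p : nat).
Implicit Types (X : 'M[R]_(n, p)) (y : 'cV[R]_n) (b c : 'cV[R]_p).

Definition lasso_value X y : R := lasso_objective X y 1 (lasso X y 1).

(** The optimal value is a Moreau envelope of the penalty: it is differentiable
    in the response and its gradient is the residual. *)
Lemma lasso_value_expand X y (h : 'cV[R]_n) :
  `|lasso_value X (y + h) - lasso_value X y - dot (residual X y) h|
    <= 2 * sqn h.
Proof.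
have shift y1 (k : 'cV[R]_n) : lasso_value X (y1 + k) <=
    lasso_value X y1 + dot (residual X y1) k + 2^-1 * sqn k.
  apply: (le_trans (lassoP X (y1 + k) ltr01 (lasso X y1 1))).
  rewrite /lasso_value !lasso_objectiveE /residual.
  have -> : y1 + k - X *m lasso X y1 1 = (y1 - X *m lasso X y1 1) + k.
    by rewrite addrAC.
  by move: (y1 - _) => r; rewrite !dotE (dotC k r); lra.
have up := shift y h.
have := shift (y + h) (- h); rewrite addrK => lo.
have := residual_nonexpansive X (y + h) y; rewrite [y + h - y]addrC addKr.
move: lo up; move: (residual X (y + h)) (residual X y) => r' r.
rewrite !dotE opprK => lo up; rewrite (dotC r r') => ne.
have := dot_ge0 (r' - r + h); rewrite !dotE => ge.
rewrite ler_norml; apply/andP; split.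
  by move: lo up ne ge; rewrite !(dotC h) (dotC r r'); lra.
by have := dot_ge0 h; lra.
Qed.

(** The residual as a limit of difference quotients of the optimal value.
    Measurability of the residual thus reduces to that of an infimum, and
    involves no choice of a minimizer. *)
Lemma residual_coord_limit X y i :
  (k.+1%:R * (lasso_value X (y + k.+1%:R^-1 *: delta_mx i 0) - lasso_value X y))
    @[k --> \oo] --> residual X y i 0.
Proof.
apply/cvgrPdist_le => /= e e0.
have dE (u : 'cV[R]_n) : dot u (delta_mx i 0) = u i 0.
  rewrite /dot (bigD1 i)//= big1 ?addr0 ?mxE ?eqxx ?mulr1// => k ki.
  by rewrite mxE (negbTE ki) mulr0.
have c0 : (fun k => 2 * k.+1%:R^-1 : R) @ \oo --> (2 * 0 : R).
  by apply: cvgM; [exact: cvg_cst|exact: cvg_harmonic].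
rewrite mulr0 in c0.
have /cvgrPdist_le/(_ e e0) := c0; apply: filterS => k.
rewrite sub0r normrN ger0_norm ?mulr_ge0// => he.
have k0 : 0 < k.+1%:R :> R by [].
have := lasso_value_expand X y (k.+1%:R^-1 *: delta_mx i 0).
have d1 : (delta_mx i 0 : 'cV[R]_n) i 0 = 1 by rewrite mxE !eqxx.
rewrite !dotZr !dotZl !dE d1 mulr1 => h.
rewrite distrC (le_trans _ he)//.
rewrite -(ler_pM2l (_ : 0 < k.+1%:R^-1 :> R)) ?invr_gt0//.
rewrite -[X in X * `|_|]ger0_norm ?invr_ge0// -normrM mulrBr mulKf ?gt_eqF//.
by rewrite (le_trans h)// mulrCA.
Qed.

Lemma rational_approx (b : 'cV[R]_p) (e : R) : 0 < e ->
  exists q : 'cV[rat]_p, forall j, `|b j 0 - ratr (q j 0)| < e.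
Proof.
move=> e0.
have /choice[q hq] (j : 'I_p) : exists q : rat, `|b j 0 - ratr q| < e.
  have be : b j 0 - e < b j 0 by rewrite ltrBlDr ltrDl.
  have [q] := rat_in_itvoo be.
  rewrite in_itv/= => /andP[h1 h2]; exists q.
  by rewrite ger0_norm ?subr_ge0 ?(ltW h2)//; lra.
by exists (\col_j q j) => j; rewrite mxE.
Qed.

Lemma lasso_objective_near X y b (e : R) : 0 < e ->
  exists2 r : R, 0 < r & forall c : 'cV[R]_p, (forall j, `|b j 0 - c j 0| < r) ->
    `|lasso_objective X y 1 c - lasso_objective X y 1 b| < e.
Proof.
move=> e0.
have /cvgrPdist_lt/(_ e e0) := @lasso_objective_continuous R n p X y 1 b^T.
move=> /nbhs_ballP[r /= r0 hr]; exists r => // c hc.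
have := hr c^T; rewrite /= !trmxK distrC; apply; split => // i j.
by rewrite ord1 !mxE; exact: hc.
Qed.

(** By continuity of the objective the infimum may be taken over the countable
    set of rational vectors. *)
Lemma lasso_value_ltP X y (a : R) : lasso_value X y < a <->
  exists q : 'cV[rat]_p, lasso_objective X y 1 (\col_j ratr (q j 0)) < a.
Proof.
split=> [va|[q]]; last exact: le_lt_trans (lassoP X y ltr01 _).
have [r r0 hr] := lasso_objective_near X y (lasso X y 1)
  (ltac:(by rewrite subr_gt0) : 0 < a - lasso_value X y).
have [q hq] := rational_approx (lasso X y 1) r0.
exists q; have := hr (\col_j ratr (q j 0)).
rewrite -/(lasso_value X y) => h.
have {}h : `|lasso_objective X y 1 (\col_j ratr (q j 0)) - lasso_value X y| <
    a - lasso_value X y by apply: h => j; rewrite mxE.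
by move: h; rewrite ltr_norml => /andP[_]; rewrite ltrD2r.
Qed.

Context d (T : measurableType d).
Variables (Xf : T -> 'M[R]_(n, p)) (yf : T -> 'cV[R]_n).
Hypothesis mX : forall i j, measurable_fun setT (fun w => Xf w i j).

Lemma measurable_lasso_value (zf : T -> 'cV[R]_n) :
  (forall i, measurable_fun setT (fun w => zf w i 0)) ->
  measurable_fun setT (fun w => lasso_value (Xf w) (zf w)).
Proof.
move=> mz; apply: (measurability _ (RGenInftyO.measurableE R)) => /= _ [_ [a ->] <-].
rewrite setTI.
pose F (k : nat) := if @unpickle 'cV[rat]_p k is Some q then
  [set w | lasso_objective (Xf w) (zf w) 1 (\col_j ratr (q j 0)) < a] else set0.
rewrite (_ : _ @^-1` _ = \bigcup_k F k); last first.
  apply/seteqP; split=> w /=.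
    rewrite in_itv/= => /lasso_value_ltP[q hq]; exists (pickle q) => //.
    by rewrite /F pickleK.
  rewrite in_itv/= => -[k _]; rewrite /F; case: unpickle => // q hq.
  by apply/lasso_value_ltP; exists q.
apply: bigcupT_measurable => k; rewrite /F; case: unpickle => // q.
apply: measurable_set_ltr => //.
apply: measurable_funD; last exact: measurable_cst.
apply: measurable_funM => //; apply: measurable_sum => i.
apply: measurable_funX; apply: measurable_funB => //.
under eq_fun do rewrite mxE.
apply: measurable_sum => j; apply: measurable_funM => //.
Qed.

Hypothesis my : forall i, measurable_fun setT (fun w => yf w i 0).

Lemma measurable_residual i :
  measurable_fun setT (fun w => residual (Xf w) (yf w) i 0).
Proof.
apply: (measurable_fun_cvg _ (fun w _ => @residual_coord_limit (Xf w) (yf w) i)).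
move=> k; apply: measurable_funM => //; apply: measurable_funB; last first.
  exact: measurable_lasso_value.
apply: measurable_lasso_value => i'.
under eq_fun do rewrite mxE.
exact: measurable_funD.
Qed.

End residual_measurability.

(** * Independence of disjoint blocks of a finite family *)

Section independence.
Local Open Scope ereal_scope.
Context d (Omega : measurableType d) (R : realType) (P : probability Omega R).
Variables (I : finType) (V : I -> {RV P >-> R}).
Hypothesis indepV : mutually_independent V.
Implicit Types J : {set I}.

(** A pi-system generating the sigma-algebra of the family indexed by J; the
    independence hypothesis speaks of its members. *)
Definition cylinders (J : {set I}) : set (set Omega) :=
  [set A | exists2 B : I -> set R, (forall i, measurable (B i)) &
    A = \bigcap_(i in [set` J]) (V i @^-1` B i)].

(** The sample space with the sigma-algebra generated by the variables indexed by
    J. Using one underlying set for all blocks, a function of the block J is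
    simply a function on the sample space that is measurable for this
    structure. *)
Definition block (J : {set I}) := g_sigma_algebraType (cylinders J).

Lemma cylindersI J : setI_closed (cylinders J).
Proof.
move=> _ _ [B mB ->] [C mC ->]; exists (fun i => B i `&` C i).
  by move=> i; exact: measurableI.
by rewrite -bigcapI; apply: eq_bigcapr => i _; rewrite preimage_setI.
Qed.

Lemma cylindersT J : cylinders J setT.
Proof. by exists (fun=> setT) => //; rewrite bigcapT. Qed.

Lemma measurable_cylinder J A : cylinders J A -> measurable A.
Proof.
move=> [B mB ->]; apply: fin_bigcap_measurable => [|i _].
  exact: finite_finset.
by rewrite -[X in measurable X]setTI; exact: measurable_funP.
Qed.

Lemma measurable_block_coord J i : i \in J ->
  measurable_fun setT (V i : block J -> R).
Proof.
move=> iJ _ B mB; rewrite setTI; apply: sub_sigma_algebra.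
exists (fun k => if k == i then B else setT).
  by move=> k; case: ifP.
apply/seteqP; split => w /=.
  by move=> Bw k _ /=; case: eqP => [->|].
by move=> /(_ i iJ); rewrite /= eqxx.
Qed.

Lemma measurable_block J (A : set (block J)) :
  measurable A -> measurable (A : set Omega).
Proof.
move: A; apply: smallest_sub; first exact: sigma_algebra_measurable.
exact: measurable_cylinder.
Qed.

Lemma measurable_to_block J : measurable_fun setT (idfun : Omega -> block J).
Proof. by move=> _ A mA; rewrite setTI preimage_id; exact: measurable_block. Qed.

Lemma measurable_block_fun J d' (T : measurableType d') (f : block J -> T) :
  measurable_fun setT f -> measurable_fun setT (f : Omega -> T).
Proof. by move=> mf; apply: (measurableT_comp mf (@measurable_to_block J)). Qed.

HB.instance Definition _ J := isMeasurableFun.Build _ _ Omega (block J)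
  (idfun : Omega -> block J) (@measurable_to_block J).

(** Two applications of the uniqueness theorem for finite measures that agree on
    a pi-system: first the event of the second block is a cylinder and the
    event of the first block varies, then the converse. *)
Lemma block_indep J1 J2 (A : set (block J1)) (B : set (block J2)) :
  (forall i, i \in J1 -> i \notin J2) -> measurable A -> measurable B ->
  P (A `&` B) = P A * P B.
Proof.
move=> J12 mA mB.
have mB' := measurable_block mB.
have nn C : (0 <= fine (P C))%R by exact: fine_ge0.
have fE C : measurable C -> (fine (P C))%:E = P C.
  by move=> mC; rewrite fineK// fin_num_measure.
have cyl A' B' : cylinders J1 A' -> cylinders J2 B' -> P (A' `&` B') = P A' * P B'.
  move=> [B1 mB1 ->] [B2 mB2 ->].
  pose B3 i := if i \in J1 then B1 i else B2 i.
  have mB3 i : measurable (B3 i) by rewrite /B3; case: ifP.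
  have E1 : \bigcap_(i in [set` J1]) (V i @^-1` B1 i) =
      \bigcap_(i in [set` J1]) (V i @^-1` B3 i).
    by apply: eq_bigcapr => i /= iJ; rewrite /B3 iJ.
  have E2 : \bigcap_(i in [set` J2]) (V i @^-1` B2 i) =
      \bigcap_(i in [set` J2]) (V i @^-1` B3 i).
    apply: eq_bigcapr => i /= iJ; rewrite /B3 ifF//.
    by apply/negbTE/negP => /J12; rewrite iJ.
  rewrite E1 E2 -bigcap_setU.
  have -> : [set` J1] `|` [set` J2] = [set` (J1 :|: J2)%SET].
    by apply/seteqP; split => i /=; rewrite inE => /orP.
  rewrite !indepV// (finset.big_setID J1)/= finset.setUK.
  congr (_ * _); apply: eq_bigl => i; rewrite !inE.
  by have [/J12/negbTE ->|] := boolP (i \in J1).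
have mscaleE (C D : set Omega) : measurable C ->
    mscale (NngNum (nn C)) P D = P D * P C.
  by move=> mC; rewrite /mscale/= fE// muleC.
have half A' B' : (cylinders J1).-sigma.-measurable A' -> cylinders J2 B' ->
    P (A' `&` B') = P A' * P B'.
  move=> mA' cB'; have mB1 := measurable_cylinder cB'.
  rewrite -mscaleE// -/(mrestr P mB1 A').
  apply: (g_sigma_algebra_measure_unique (cylinders J1) _ (fun=> setT)) => //.
  - by move=> C /measurable_cylinder.
  - by move=> _; exact: cylindersT.
  - by rewrite bigcup_const.
  - exact: cylindersI.
  - by move=> C cC; transitivity (P C * P B'); [exact: cyl|exact/esym/mscaleE].
  - move=> _; change (P (setT `&` B') < +oo).
    by rewrite setTI ltey_eq fin_num_measure.
rewrite setIC muleC -mscaleE; last exact: measurable_block.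
have mA1 := measurable_block mA.
rewrite -/(mrestr P mA1 B).
apply: (g_sigma_algebra_measure_unique (cylinders J2) _ (fun=> setT)) => //.
- by move=> C /measurable_cylinder.
- by move=> _; exact: cylindersT.
- by rewrite bigcup_const.
- exact: cylindersI.
- move=> C cC; transitivity (P C * P A); last exact/esym/mscaleE.
  by rewrite muleC -half// setIC.
- move=> _; change (P (setT `&` A) < +oo).
  by rewrite setTI ltey_eq fin_num_measure.
Qed.

Section two_blocks.
Variables J1 J2 : {set I}.
Hypothesis J12 : forall i, i \in J1 -> i \notin J2.

Definition block_law J := distribution P (idfun : {mfun Omega >-> block J}).
Arguments block_law : clear implicits.
HB.instance Definition _ J := Probability.on (block_law J).

Definition block_diagonal (w : Omega) : block J1 * block J2 := (w, w).

Lemma measurable_block_diagonal : measurable_fun setT block_diagonal.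
Proof. exact: (measurable_fun_pair (@measurable_to_block J1) (@measurable_to_block J2)). Qed.

HB.instance Definition _ := isMeasurableFun.Build _ _ Omega (block J1 * block J2)%type
  block_diagonal measurable_block_diagonal.

(** Independence of two blocks in integrated form: the law of a sample point,
    seen once in each block, is the product of the two laws. It gives access to
    Fubini's theorem. *)
Lemma distribution_block_diagonal (C : set (block J1 * block J2)) : measurable C ->
  distribution P block_diagonal C = (block_law J1 \x block_law J2) C.
Proof.
move=> mC; apply/esym; apply: product_measure_unique => // A B mA mB.
exact: (block_indep J12 mA mB).
Qed.

(** Conditioning on the first block: if the event C has conditional probability
    at most q given any point of A, then A and C occur together with
    probability at most q P(A). *)
Lemma section_bound (A : set (block J1)) (C : set (block J1 * block J2)) (q : R) :
  measurable A -> measurable C -> (0 <= q)%R ->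
  (forall w, A w -> P (xsection C w) <= q%:E) ->
  P (A `&` [set w | C (w, w)]) <= q%:E * P A.
Proof.
move=> mA mC q0 hq.
have mAT : measurable (A `*` setT : set (block J1 * block J2)) by exact: measurableX.
rewrite (_ : A `&` _ = block_diagonal @^-1` ((A `*` setT) `&` C)); last first.
  by apply/seteqP; split => w [] /=; [split|move=> []].
rewrite -[leLHS]/(distribution P block_diagonal _) distribution_block_diagonal; last exact: measurableI.
rewrite /product_measure1/= (_ : q%:E * P A = \int[block_law J1]_w (q%:E * (\1_A w)%:E)).
  apply: ge0_le_integral => //.
  - exact/measurable_fun_xsection/measurableI.
  - by apply: measurable_funeM; apply/measurable_EFinP; exact: measurable_indic.
  move=> w _ /=; rewrite xsectionI.
  have [wA|wA] := boolP (w \in A).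
    rewrite in_xsectionX// setTI indicE wA mule1.
    by apply: hq; exact: set_mem.
  by rewrite notin_xsectionX// set0I measure0 mule_ge0// lee_fin.
rewrite ge0_integralZl//; last by apply/measurable_EFinP; exact: measurable_indic.
by rewrite integral_indic// setIT.
Qed.

Lemma block_ge0_integralM (f : block J1 -> \bar R) (g : block J2 -> \bar R) :
  measurable_fun setT f -> measurable_fun setT g ->
  (forall w, 0 <= f w) -> (forall w, 0 <= g w) ->
  \int[P]_w (f w * g w) = \int[P]_w f w * \int[P]_w g w.
Proof.
move=> mf mg f0 g0.
pose h (x : block J1 * block J2) := f x.1 * g x.2.
have mh : measurable_fun setT h.
  apply: emeasurable_funM; [exact: (measurableT_comp mf)|exact: (measurableT_comp mg)].
have h0 x : 0 <= h x by rewrite mule_ge0.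
transitivity (\int[distribution P block_diagonal]_x h x).
  by rewrite ge0_integral_distribution.
rewrite (eq_measure_integral (block_law J1 \x block_law J2)); last first.
  by move=> A mA _; exact: distribution_block_diagonal.
rewrite fubini_tonelli1// /fubini_F /=.
have fE : \int[P]_w f w = \int[block_law J1]_w f w by rewrite ge0_integral_distribution.
have gE : \int[P]_w g w = \int[block_law J2]_w g w by rewrite ge0_integral_distribution.
rewrite fE gE; set c := \int[block_law J2]_w g w.
transitivity (\int[block_law J1]_w (c * f w)).
  apply: eq_integral => w _.
  by rewrite muleC /c -ge0_integralZl.
by rewrite ge0_integralZl//; [rewrite muleC|exact: integral_ge0].
Qed.

End two_blocks.

End independence.

(** * Lebesgue integrals of Gaussian densities *)

Section gaussian_calculus.
Variable R : realType.
Local Notation mu := (@lebesgue_measure R).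
Local Notation RR := (measurableTypeR R).
Local Open Scope ereal_scope.

Lemma measurable_affine (c t : R) : measurable_fun setT ((fun x => c * x + t)%R : RR -> RR).
Proof. by apply: measurable_funD => //; exact: measurable_funM. Qed.

(** Both sides are measures that agree on half-open intervals. *)
Lemma lebesgue_measure_affine (c t : R) (A : set R) : (0 < c)%R -> measurable A ->
  pushforward mu ((fun x => c * x + t)%R : RR -> RR) A = (c^-1)%:E * mu A.
Proof.
move=> c0 mA; set aff := (X in pushforward mu X).
have maff := measurable_affine c t.
have cn : (0 <= c)%R by exact: ltW.
pose push : {measure set RR -> \bar R} :=
  measure_function_pushforward__canonical__measure_function_Measure mu maff.
have key B : measurable B -> mu B = mscale (NngNum cn) push B.
  apply: lebesgue_measure_unique => _ [[a b]] _ <-.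
  change (mu `]a, b]%classic = c%:E * mu (aff @^-1` `]a, b]%classic)).
  have -> : aff @^-1` `]a, b]%classic = `]((a - t) / c)%R, ((b - t) / c)%R]%classic.
    apply/seteqP; split => x; rewrite /aff /= !in_itv/= ltr_pdivrMr// ler_pdivlMr//;
    by rewrite ltrBlDr lerBrDr (mulrC x).
  rewrite !lebesgue_measure_itv/= !lte_fin ltr_pM2r ?invr_gt0// ltrD2r.
  case: ifP => _; last by rewrite mule0.
  rewrite -!EFinB -EFinM; congr EFin; field.
  exact: lt0r_neq0.
rewrite key//; change (mu (aff @^-1` A) = (c^-1)%:E * (c%:E * mu (aff @^-1` A))).
by rewrite muleA -EFinM mulVf ?gt_eqF// mul1e.
Qed.

Lemma ge0_integral_affine (c t : R) (f : R -> \bar R) : (0 < c)%R ->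
  measurable_fun setT f -> (forall x, 0 <= f x) ->
  \int[mu]_x f (c * x + t)%R = (c^-1)%:E * \int[mu]_x f x.
Proof.
move=> c0 mf f0.
have maff := measurable_affine c t.
have cn : (0 <= c^-1)%R by rewrite invr_ge0 ltW.
transitivity (\int[pushforward mu ((fun x => c * x + t)%R : RR -> RR)]_x f x).
  by rewrite ge0_integral_pushforward.
rewrite (eq_measure_integral (mscale (NngNum cn) mu)); last first.
  by move=> A mA _; exact: lebesgue_measure_affine.
by rewrite ge0_integral_mscale.
Qed.

Lemma ge0_integral_reflection (f : R -> \bar R) :
  measurable_fun setT f -> (forall x, 0 <= f x) ->
  \int[mu]_x f (- x)%R = \int[mu]_x f x.
Proof.
move=> mf f0.
transitivity (\int[pushforward mu (-%R : RR -> RR)]_x f x).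
  by rewrite ge0_integral_pushforward.
by apply: eq_measure_integral => A mA _; exact: lebesgue_measureN.
Qed.

Lemma normal_probE (s : R) (A : set R) : measurable A ->
  normal_prob 0 s A = \int[mu]_x ((\1_A x)%:E * (normal_pdf 0 s x)%:E).
Proof.
move=> mA; rewrite /normal_prob integral_mkcond; apply: eq_integral => x _.
by rewrite epatch_indic muleC.
Qed.

Lemma measurable_pdf (m s : R) : measurable_fun setT (fun x => (normal_pdf m s x)%:E).
Proof. by apply/measurable_EFinP; exact: measurable_normal_pdf. Qed.

Lemma pdf_ge0 (m s x : R) : 0 <= (normal_pdf m s x)%:E.
Proof. by rewrite lee_fin normal_pdf_ge0. Qed.

Import HBNNSimple.

(** Integration against a law with a density, by monotone approximation with
    simple functions. *)
Lemma ge0_integral_normal_prob (s : R) (f : RR -> \bar R) :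
  measurable_fun setT f -> (forall x, 0 <= f x) ->
  \int[normal_prob 0 s]_x f x = \int[mu]_x (f x * (normal_pdf 0 s x)%:E).
Proof.
move=> mf f0; pose g x := (normal_pdf 0 s x)%:E.
have mg : measurable_fun setT g := measurable_pdf 0 s.
have g0 x : 0 <= g x by exact: pdf_ge0.
pose h := nnsfun_approx measurableT mf.
have hf x : limn (fun n => (h n x)%:E) = f x.
  by apply/cvg_lim => //; exact: cvg_nnsfun_approx.
have nd x : {homo (fun n => (h n x)%:E) : a b / (a <= b)%N >-> a <= b}.
  by move=> a b ab; rewrite lee_fin; exact/lefP/nd_nnsfun_approx.
have simple n : \int[normal_prob 0 s]_x (h n x)%:E = \int[mu]_x ((h n x)%:E * g x).
  have E x : (h n x)%:E = \sum_(y \in range (h n)) y%:E * (\1_(h n @^-1` [set y]) x)%:E.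
    by rewrite fimfunE -fsumEFin.
  have nn y x : 0 <= y%:E * (\1_(h n @^-1` [set y]) x)%:E :> \bar R.
    exact: nnfun_muleindic_ge0.
  have mi y : measurable_fun setT (fun x => (\1_(h n @^-1` [set y]) x : R)%:E).
    by apply/measurable_EFinP; exact: measurable_indic.
  under eq_integral do rewrite E.
  under [RHS]eq_integral do rewrite E ge0_mule_fsuml//.
  rewrite !ge0_integral_fsum//.
  - apply: eq_fsbigr => y; rewrite inE => -[x _ <-].
    under [RHS]eq_integral do rewrite -muleA.
    have mA : measurable (h n @^-1` [set h n x]).
      by rewrite -[X in measurable X]setTI; exact: measurable_funP.
    rewrite ge0_integralZl// ?lee_fin// integral_indic// setIT.
    rewrite ge0_integralZl// ?lee_fin//; first by congr (_ * _); exact: normal_probE.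
      exact: emeasurable_funM.
    by move=> z _; rewrite mule_ge0// lee_fin.
  - by move=> y; apply: emeasurable_funM => //; exact: measurable_funeM.
  - by move=> y x _; rewrite mule_ge0.
  - by move=> y; exact: measurable_funeM.
transitivity (limn (fun n => \int[normal_prob 0 s]_x (h n x)%:E)).
  rewrite -monotone_convergence//; first by apply: eq_integral => x _; rewrite hf.
  - by move=> n; exact/measurable_EFinP/measurable_funP.
  - by move=> n x _; rewrite lee_fin.
under eq_fun do rewrite simple.
rewrite -monotone_convergence//.
- apply: eq_integral => x _; rewrite -hf -limeMr//.
  by apply/cvg_ex; exists (f x); exact: cvg_nnsfun_approx.
- by move=> n; apply: emeasurable_funM => //; exact/measurable_EFinP/measurable_funP.
- by move=> n x _; rewrite mule_ge0// lee_fin.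
- by move=> x _ a b ab; rewrite lee_wpmul2r//; exact: nd.
Qed.

End gaussian_calculus.

(** * Linear combinations of independent Gaussian variables *)

Section gaussian_law.
Context d (Omega : measurableType d) (R : realType) (P : probability Omega R).
Local Notation mu := (@lebesgue_measure R).

(** The centered normal law of standard deviation s, with the convention that
    s = 0 denotes the point mass at 0. It is a predicate on plain functions so
    that it applies to functions of a block. *)
Definition gaussian_law (W : Omega -> R) (s : R) : Prop :=
  forall A : set R, measurable A ->
    P (W @^-1` A) = if s == 0 then \d_(0 : R) A else normal_prob 0 s A.

Lemma normal_pdf_scale (c s x : R) : 0 < c -> s != 0 ->
  normal_pdf 0 (c * s) (c * x) = c^-1 * normal_pdf 0 s x.
Proof.
move=> c0 s0; have cs0 : c * s != 0 by rewrite mulf_neq0// gt_eqF.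
rewrite !normal_pdfE// /normal_peak /normal_fun !subr0 mulrA; congr (_ * expR _).
  rewrite exprMn -mulrA -mulrnAr sqrtrM ?sqr_ge0// sqrtr_sqr (gtr0_norm c0).
  by rewrite invfM.
rewrite !exprMn; field; rewrite s0 gt_eqF//=.
Qed.

(** A change of variables in the density for a positive factor; the case of a
    negative factor follows from the symmetry of the density. *)
Lemma gaussian_law_scale (W : Omega -> R) (s c : R) :
  gaussian_law W s -> gaussian_law (fun w => c * W w) (`|c| * s).
Proof.
move=> gW A mA.
pose B := (fun x => c * x) @^-1` A.
have mB : measurable B.
  rewrite /B -[X in measurable X]setTI.
  by apply: (measurable_funM (measurable_cst c) (@measurable_id _ _ setT)).
rewrite -[LHS]/(P (W @^-1` B)) gW// mulf_eq0 normr_eq0.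
have [s0|s0] := eqVneq s 0.
  rewrite orbT !diracE (_ : (0 \in B) = (0 \in A))//.
  by apply/idP/idP => /set_mem h; apply/mem_set; move: h; rewrite /B/= mulr0.
have [c0|c0] := eqVneq c 0.
  rewrite /= diracE.
  have [A0|A0] := boolP (0 \in A).
    rewrite (_ : B = setT) ?probability_setT//.
    by apply/seteqP; split => x //= _; rewrite /B/= c0 mul0r; exact: set_mem.
  rewrite (_ : B = set0) ?measure0//.
  apply/seteqP; split => x //=; rewrite /B/= c0 mul0r => /mem_set.
  by rewrite (negbTE A0).
rewrite /=.
have main (c' : R) (D : set R) : 0 < c' -> measurable D ->
    measurable ((fun x => c' * x) @^-1` D) ->
    normal_prob 0 s ((fun x => c' * x) @^-1` D) = normal_prob 0 (c' * s) D.
  move=> c'0 mD mD'; rewrite !normal_probE//.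
  transitivity (c'%:E * \int[mu]_x
     ((fun z => (\1_D z)%:E * (normal_pdf 0 (c' * s) z)%:E) (c' * x + 0)%R))%E.
    rewrite -ge0_integralZl//=; last 3 first.
    - apply: emeasurable_funM.
        apply/measurable_EFinP; apply: (measurableT_comp (measurable_indic mD)).
        exact: measurable_affine.
      apply/measurable_EFinP; apply: (measurableT_comp (measurable_normal_pdf _ _)).
      exact: measurable_affine.
    - by move=> x _; rewrite mule_ge0// lee_fin normal_pdf_ge0.
    - by rewrite lee_fin ltW.
    apply: eq_integral => x _.
    rewrite addr0 normal_pdf_scale// -!EFinM; congr EFin.
    by rewrite !indicE [RHS]mulrCA mulVKf ?gt_eqF.
  rewrite (@ge0_integral_affine R c' 0
    (fun z => ((\1_D z)%:E * (normal_pdf 0 (c' * s) z)%:E)%E))//.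
  - by rewrite muleA -EFinM divff ?gt_eqF// mul1e.
  - apply: emeasurable_funM; last exact: measurable_pdf.
    by apply/measurable_EFinP; exact: measurable_indic.
  - by move=> x; rewrite mule_ge0// lee_fin normal_pdf_ge0.
have [cp|cn] := ltrP 0 c; first by rewrite gtr0_norm// main.
have {}cn : 0 < - c by rewrite oppr_gt0 lt_neqAle c0.
rewrite ltr0_norm -?oppr_gt0// -main//; last first.
  rewrite -[X in measurable X]setTI.
  by apply: (measurable_funM (measurable_cst (- c)) (@measurable_id _ _ setT)).
set B' := _ @^-1` A.
have mB' : measurable B'.
  rewrite /B' -[X in measurable X]setTI.
  by apply: (measurable_funM (measurable_cst (- c)) (@measurable_id _ _ setT)).
rewrite !normal_probE// -(ge0_integral_reflection (f := fun x => ((\1_B x)%:E * (normal_pdf 0 s x)%:E)%E)).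
- apply: eq_integral => x _; congr ((_ %:E * _ %:E)%E).
    rewrite !indicE; congr ((nat_of_bool _)%:R).
    by apply/idP/idP => /set_mem h; apply/mem_set; move: h;
      rewrite /B /B'/= mulrN mulNr.
  by rewrite !normal_pdfE// /normal_fun !subr0 sqrrN.
- apply: emeasurable_funM; last exact: measurable_pdf.
  by apply/measurable_EFinP; exact: measurable_indic.
- by move=> x; rewrite mule_ge0// lee_fin normal_pdf_ge0.
Qed.

End gaussian_law.

Section gaussian_convolution.
Variable R : realType.
Local Notation mu := (@lebesgue_measure R).
Local Notation RR := (measurableTypeR R).

(** Completing the square: as a function of u, the product of the two densities
    is proportional to a normal density, and the factor is the normal density
    of variance a^2 + b^2 at y. *)
Lemma normal_pdf_convolution (a b u y : R) : 0 < a -> 0 < b ->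
  normal_pdf 0 b (y - u) * normal_pdf 0 a u =
  normal_pdf 0 (Num.sqrt (a ^+ 2 + b ^+ 2)) y *
  normal_pdf (y * a ^+ 2 / (a ^+ 2 + b ^+ 2))
    (a * b / Num.sqrt (a ^+ 2 + b ^+ 2)) u.
Proof.
move=> a0 b0; set c2 := a ^+ 2 + b ^+ 2; set c := Num.sqrt c2.
have c20 : 0 < c2 by rewrite addr_gt0 ?exprn_gt0.
have c0 : 0 < c by rewrite sqrtr_gt0.
have cc : c ^+ 2 = c2 by rewrite sqr_sqrtr// ltW.
have abc0 : 0 < a * b / c by rewrite divr_gt0// mulr_gt0.
rewrite !normal_pdfE ?gt_eqF// /normal_peak /normal_fun !subr0.
have pk s : 0 < s -> Num.sqrt (s ^+ 2 * pi *+ 2) = s * Num.sqrt (pi *+ 2).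
  by move=> s0; rewrite -mulrnAr sqrtrM ?sqr_ge0// sqrtr_sqr gtr0_norm.
rewrite !pk// mulrACA -expRD [RHS]mulrACA -expRD; congr (_ * expR _).
  have p0 : Num.sqrt (pi *+ 2) != 0 :> R.
    by rewrite gt_eqF// sqrtr_gt0 pmulrn_lgt0// pi_gt0.
  by field; rewrite p0 !gt_eqF.
rewrite !exprMn exprVn cc /c2; field.
by rewrite !gt_eqF//= -?/c2// ?exprn_gt0//; rewrite gt_eqF.
Qed.

Lemma integral_normal_pdf_convolution (a b y : R) : 0 < a -> 0 < b ->
  (\int[mu]_u ((normal_pdf 0 b (y - u))%:E * (normal_pdf 0 a u)%:E) =
  (normal_pdf 0 (Num.sqrt (a ^+ 2 + b ^+ 2)) y)%:E)%E.
Proof.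
move=> a0 b0.
under eq_integral do rewrite -EFinM normal_pdf_convolution// EFinM.
rewrite ge0_integralZl//.
- by rewrite integral_normal_pdf mule1.
- exact: measurable_pdf.
- by move=> x _; exact: pdf_ge0.
- by rewrite lee_fin normal_pdf_ge0.
Qed.

Let shifted_pdf (b : R) (A : set R) (x : RR * RR) : \bar R :=
  ((\1_A x.2)%:E * (normal_pdf 0 b (x.2 - x.1))%:E)%E.

Let measurable_shifted_pdf b A : measurable A ->
  measurable_fun setT (shifted_pdf b A).
Proof.
move=> mA; apply: emeasurable_funM; apply/measurable_EFinP.
  by apply: (measurableT_comp (measurable_indic mA)); exact: measurable_snd.
apply: (measurableT_comp (measurable_normal_pdf 0 b)).
by apply: measurable_funB; [exact: measurable_snd|exact: measurable_fst].
Qed.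

Let shifted_pdf_ge0 b A x : (0 <= shifted_pdf b A x)%E.
Proof. by rewrite mule_ge0 ?pdf_ge0// lee_fin. Qed.

Lemma measurable_shift (u : R) (A : set R) : measurable A ->
  measurable [set v | A (u + v)].
Proof.
move=> mA; rewrite -[X in measurable X]setTI.
by apply: (measurable_funD (measurable_cst u) (@measurable_id _ _ setT)).
Qed.

Let normal_prob_shiftE (b : R) (A : set R) u : measurable A ->
  normal_prob 0 b [set v | A (u + v)] = fubini_F mu (shifted_pdf b A) u.
Proof.
move=> mA; have mAu := measurable_shift u mA.
rewrite normal_probE//; rewrite /fubini_F/=.
pose g v := ((\1_[set v | A (u + v)%R] v)%:E * (normal_pdf 0 b v)%:E)%E.
have := @ge0_integral_affine R 1 (- u) g ltr01; rewrite invr1 mul1e => <-.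
- apply: eq_integral => y _; rewrite /shifted_pdf /g /= mul1r; congr (_%:E * _)%E.
  rewrite !indicE; congr ((nat_of_bool _)%:R).
  by apply/idP/idP => /set_mem h1; apply/mem_set; move: h1;
    rewrite /= addrCA subrr addr0.
- apply: emeasurable_funM; last exact: measurable_pdf.
  by apply/measurable_EFinP; exact: measurable_indic.
- by move=> x; rewrite mule_ge0 ?pdf_ge0// lee_fin.
Qed.

Lemma measurable_normal_prob_shift (b : R) (A : set R) : measurable A ->
  measurable_fun setT (fun u : RR => normal_prob 0 b [set v | A (u + v)]).
Proof.
move=> mA; under eq_fun do rewrite normal_prob_shiftE//.
apply: measurable_fun_fubini_tonelli_F; first exact: measurable_shifted_pdf.
by move=> x; exact: shifted_pdf_ge0.
Qed.

(** Tonelli's theorem, after the translation v = y - u, reduces the convolution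
    of the laws to that of the densities. *)
Lemma normal_prob_convolution (a b : R) (A : set R) : 0 < a -> 0 < b ->
  measurable A ->
  (\int[normal_prob 0 a]_u normal_prob 0 b [set v | A (u + v)%R] =
   normal_prob 0 (Num.sqrt (a ^+ 2 + b ^+ 2)) A)%E.
Proof.
move=> a0 b0 mA.
pose h (x : RR * RR) := (shifted_pdf b A x * (normal_pdf 0 a x.1)%:E)%E.
have mk := measurable_shifted_pdf b mA.
have mh : measurable_fun setT h.
  apply: emeasurable_funM => //; apply/measurable_EFinP.
  by apply: (measurableT_comp (measurable_normal_pdf 0 a)); exact: measurable_fst.
have h0 x : (0 <= h x)%E by rewrite mule_ge0 ?pdf_ge0// shifted_pdf_ge0.
rewrite ge0_integral_normal_prob//; last exact: measurable_normal_prob_shift.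
transitivity (\int[mu]_u fubini_F mu h u)%E.
  apply: eq_integral => u _.
  rewrite normal_prob_shiftE// /fubini_F /h /= muleC -ge0_integralZl//.
  - by apply: eq_integral => y _; rewrite muleC.
  - exact: (measurableT_comp mk (measurable_pair1 u)).
  - by rewrite pdf_ge0.
rewrite -fubini_tonelli1// fubini_tonelli2// normal_probE//.
apply: eq_integral => y _; rewrite /fubini_G /h /shifted_pdf /=.
rewrite -integral_normal_pdf_convolution// -ge0_integralZl//.
- by apply: eq_integral => u _; rewrite muleA.
- apply: emeasurable_funM; last exact: measurable_pdf.
  apply/measurable_EFinP; apply: (measurableT_comp (measurable_normal_pdf 0 b)).
  by apply: measurable_funB => //; exact: measurable_cst.
- by move=> u _; rewrite mule_ge0 ?pdf_ge0.
Qed.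

End gaussian_convolution.

Section gaussian_sums.
Context d (Omega : measurableType d) (R : realType) (P : probability Omega R).
Variables (I : finType) (V : I -> {RV P >-> R}).
Hypothesis indepV : mutually_independent V.

(** The law of a sum of functions of disjoint blocks is the convolution of their
    laws. The degenerate cases a = 0 and b = 0 are separate because a point
    mass has no density. *)
Lemma gaussian_law_add (J1 J2 : {set I}) (U : block V J1 -> R) (W : block V J2 -> R)
    (a b : R) : (forall i, i \in J1 -> i \notin J2) ->
  measurable_fun setT U -> measurable_fun setT W -> 0 <= a -> 0 <= b ->
  gaussian_law P U a -> gaussian_law P W b ->
  gaussian_law P (fun w => U w + W w) (Num.sqrt (a ^+ 2 + b ^+ 2)).
Proof.
move=> J12 mU mW a0 b0 gU gW A mA.
pose C := [set x : block V J1 * block V J2 | A (U x.1 + W x.2)].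
have mC : measurable C.
  rewrite -[X in measurable X]setTI.
  apply: (measurable_funD (measurableT_comp mU measurable_fst)
     (measurableT_comp mW measurable_snd)) => //.
have mUO : measurable_fun setT (U : Omega -> measurableTypeR R) :=
  measurable_block_fun mU.
have step : (P ((fun w => U w + W w)%R @^-1` A) =
    \int[P]_w P (W @^-1` [set v | A (U w + v)%R]))%E.
  rewrite -[LHS]/(distribution P (@block_diagonal _ _ _ P I V J1 J2) C) distribution_block_diagonal//.
  rewrite /product_measure1/= ge0_integral_distribution//=; last first.
    exact: measurable_fun_xsection.
  apply: eq_integral => w _; rewrite /comp /= /block_law/= /distribution /pushforward/=.
  congr (P _); apply/seteqP; split => w' /=; rewrite /xsection/= inE //.
rewrite step.
under eq_integral do rewrite (gW _ (measurable_shift _ mA)).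
have [b_0|b_neq0] := eqVneq b 0.
  rewrite b_0 expr0n/= addr0 sqrtr_sqr ger0_norm// -gU//.
  rewrite -[X in _ = P X]setIT -integral_indic//; last first.
    by rewrite -[X in measurable X]setTI; exact: mUO.
  apply: eq_integral => w _; rewrite diracE indicE; congr (nat_of_bool _)%:R%:E.
  by apply/idP/idP => /set_mem h; apply/mem_set; move: h; rewrite /= addr0.
have mphi := measurable_normal_prob_shift b mA.
rewrite -[LHS](ge0_integral_pushforward mUO P measurableT mphi); last first.
  by move=> u _; exact: measure_ge0.
have [a_0|a_neq0] := eqVneq a 0.
  rewrite a_0 expr0n/= add0r sqrtr_sqr ger0_norm// (negbTE b_neq0).
  transitivity (\int[@dirac _ (measurableTypeR R) 0%R R]_u
      normal_prob 0 b [set v | A (u + v)%R])%E.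
    apply: eq_measure_integral => D mD _.
    by rewrite -[LHS]/(P (U @^-1` D)) gU// a_0 eqxx.
  rewrite integral_dirac// diracT mul1e; congr (normal_prob _ _ _).
  by apply/seteqP; split => v; rewrite /= add0r.
transitivity (\int[normal_prob 0 a]_u normal_prob 0 b [set v | A (u + v)%R])%E.
  apply: eq_measure_integral => D mD _.
  by rewrite -[LHS]/(P (U @^-1` D)) gU// (negbTE a_neq0).
have a_gt0 : 0 < a by rewrite lt_neqAle eq_sym a_neq0.
have b_gt0 : 0 < b by rewrite lt_neqAle eq_sym b_neq0.
rewrite normal_prob_convolution// ifF//.
by rewrite gt_eqF// sqrtr_gt0 addr_gt0 ?exprn_gt0.
Qed.

End gaussian_sums.

Section gaussian_lincomb.
Context d (Omega : measurableType d) (R : realType) (P : probability Omega R).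
Variables (I : finType) (V : I -> {RV P >-> R}).
Hypothesis indepV : mutually_independent V.

Lemma measurable_block_lincomb (J K : {set I}) (a : I -> R) : J \subset K ->
  measurable_fun setT
    ((fun w => \sum_(i in J) a i * V i w) : block V K -> R).
Proof.
move=> /fintype.subsetP JK.
under eq_fun do rewrite -big_enum/=.
rewrite (_ : (fun w => _) = (fun w : block V K => \sum_(i <- enum J)
    (if i \in K then a i * V i w else 0))); last first.
  apply/funext => w; rewrite !big_enum; apply: eq_bigr => i iJ.
  by rewrite (JK _ iJ).
apply: (@measurable_sum _ _ _ _ _ _
  (fun i (w : block V K) => if i \in K then a i * V i w else 0)) => i.
case: (boolP (i \in K)) => iK; last exact: measurable_cst.
by apply: measurable_funM => //; exact: measurable_block_coord.
Qed.

Lemma gaussian_law_lincomb (J : {set I}) (a : I -> R) (s : R) : 0 <= s ->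
  (forall i, i \in J -> gaussian_law P (V i) s) ->
  gaussian_law P (fun w => \sum_(i in J) a i * V i w)
    (Num.sqrt (\sum_(i in J) a i ^+ 2) * s).
Proof.
move=> s0; move: {2}#|J| (leqnn #|J|) => m; elim: m J => [|m IH] J.
  rewrite leqn0 cards_eq0 => /eqP -> _ A mA.
  rewrite big_set0 sqrtr0 mul0r eqxx.
  have -> : (fun w : Omega => \sum_(i in finset.set0) a i * V i w) = cst 0.
    by apply/funext => w; rewrite big_set0.
  rewrite (preimage_cst (0 : R) A) diracE; case: ifPn => A0; first by rewrite probability_setT.
  by rewrite measure0.
have [->|[i iJ]] := set_0Vmem J; first by move=> _; apply: IH; rewrite cards0.
rewrite (cardsD1 i) iJ add1n ltnS => Jm gV.
pose U w := \sum_(k in (J :\ i)%SET) a k * V k w.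
pose W w := a i * V i w.
have gU : gaussian_law P U (Num.sqrt (\sum_(k in (J :\ i)%SET) a k ^+ 2) * s).
  by apply: IH => // k; rewrite !inE => /andP[_]; exact: gV.
have gW : gaussian_law P W (`|a i| * s) by apply: gaussian_law_scale; exact: gV.
have add := @gaussian_law_add _ _ R P I V indepV (J :\ i)%SET [set i]%SET U W
  _ _ _ _ _ _ _ gU gW.
move: add.
have -> : Num.sqrt ((Num.sqrt (\sum_(k in (J :\ i)%SET) a k ^+ 2) * s) ^+ 2 + (`|a i| * s) ^+ 2)
    = Num.sqrt (\sum_(k in J) a k ^+ 2) * s.
  have S0 : 0 <= \sum_(k in (J :\ i)%SET) a k ^+ 2 by apply: sumr_ge0 => k _; exact: sqr_ge0.
  rewrite !exprMn sqr_sqrtr// -normrX ger0_norm ?sqr_ge0// -mulrDl.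
  rewrite sqrtrM ?addr_ge0 ?sqr_ge0// sqrtr_sqr (ger0_norm s0).
  by rewrite (big_setD1 i iJ)/= addrC.
have -> : (fun w => U w + W w) = (fun w => \sum_(k in J) a k * V k w).
  by apply/funext => w; rewrite /U /W (big_setD1 i iJ)/= addrC.
apply.
- by move=> k; rewrite !inE => /andP[/negbTE ->].
- exact: measurable_block_lincomb.
- apply: measurable_funM => //; apply: measurable_block_coord.
  by rewrite inE.
- by rewrite mulr_ge0 ?sqrtr_ge0.
- by rewrite mulr_ge0.
Qed.

End gaussian_lincomb.

(** * Gaussian tail, density and moment bounds *)

Section gaussian_estimates.
Context d (Omega : measurableType d) (R : realType) (P : probability Omega R).
Local Notation mu := (@lebesgue_measure R).

Lemma normal_peak_le (s : R) : 0 < s -> normal_peak s <= s^-1.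
Proof.
move=> s0; rewrite /normal_peak lef_pV2 ?posrE ?sqrtr_gt0 ?pmulrn_lgt0//; last first.
  by rewrite mulr_gt0 ?exprn_gt0 ?pi_gt0.
rewrite -[leLHS](ger0_norm (ltW s0)) -sqrtr_sqr ler_wsqrtr// -mulrnAr ler_peMr ?sqr_ge0//.
by have := pi_ge2 R; lra.
Qed.

Lemma normal_prob_itv_le (s a b : R) : 0 < s -> a <= b ->
  (normal_prob 0 s `[a, b] <= ((b - a) / s)%:E)%E.
Proof.
move=> s0 ab; rewrite /normal_prob.
apply: (@le_trans _ _ (\int[mu]_(x in `[a, b]) (s^-1)%:E)%E).
  apply: ge0_le_integral => //.
  - by move=> x _; exact: pdf_ge0.
  - by apply: measurable_funTS; exact: measurable_pdf.
  - move=> x _; rewrite lee_fin (le_trans _ (normal_peak_le s0))//.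
    by rewrite normal_pdf_ub// gt_eqF.
rewrite integral_cst//= lebesgue_measure_itv/= lte_fin.
case: ifP => _; first by rewrite -EFinB -EFinM mulrC.
by rewrite mule0 lee_fin divr_ge0 ?subr_ge0// ltW.
Qed.

(** The density is at most 1 / s, and the event is contained in two intervals of
    length 2 e. *)
Lemma gaussian_near_one (W : Omega -> R) (s e : R) : 0 < s -> 0 <= e ->
  measurable_fun setT W -> gaussian_law P W s ->
  (P [set w | (`| `|W w| - 1| <= e)%R] <= (4 * e / s)%:E)%E.
Proof.
move=> s0 e0 mW gW.
have mI (D : set R) : measurable D -> measurable (W @^-1` D).
  by move=> mD; rewrite -[X in measurable X]setTI; exact: mW.
pose I1 := `[1 - e, 1 + e]%classic; pose I2 := `[- (1 + e), - (1 - e)]%classic.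
have mI1 : measurable I1 by exact: measurable_itv.
have mI2 : measurable I2 by exact: measurable_itv.
have b1 : (P (W @^-1` I1) <= (2 * e / s)%:E)%E.
  rewrite gW// gt_eqF// (le_trans (normal_prob_itv_le s0 _))//; last first.
    by rewrite lee_fin ler_wpM2r ?invr_ge0 ?(ltW s0)//; lra.
  by lra.
have b2 : (P (W @^-1` I2) <= (2 * e / s)%:E)%E.
  rewrite gW// gt_eqF// (le_trans (normal_prob_itv_le s0 _))//; last first.
    by rewrite lee_fin ler_wpM2r ?invr_ge0 ?(ltW s0)//; lra.
  by lra.
apply: (@le_trans _ _ (P (W @^-1` I1 `|` W @^-1` I2))).
  apply: le_measure; rewrite ?inE.
  - apply: measurable_set_ler => //; apply: measurableT_comp => //.
    by apply: measurable_funB => //; exact: measurableT_comp.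
  - by apply: measurableU; exact: mI.
  move=> w /= ; rewrite /I1 /I2 /= !in_itv/=.
  have [W0|W0] := leP 0 (W w).
    by rewrite (ger0_norm W0) ler_norml => /andP[? ?]; left; apply/andP; split; lra.
  by rewrite (ltr0_norm W0) ler_norml => /andP[? ?]; right; apply/andP; split; lra.
apply: le_trans (measureU2 _ (mI _ mI1) (mI _ mI2)) _.
apply: (le_trans (leeD b1 b2)).
by rewrite -EFinD lee_fin; lra.
Qed.

(** The interval ]1, 1 + s] already has the mass displayed on the right, because
    the density at its right end is a lower bound on it. The factor in front of
    the exponential does not depend on s, so only the exponent matters
    asymptotically. *)
Lemma gaussian_tail_lower (W : Omega -> R) (s : R) : 0 < s ->
  measurable_fun setT W -> gaussian_law P W s ->
  (P [set w | (`|W w| <= 1)%R] <=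
    (1 - normal_peak 1 * expR (- (s^-1 + 1) ^+ 2 / 2))%:E)%E.
Proof.
move=> s0 mW gW.
have mI (D : set R) : measurable D -> measurable (W @^-1` D).
  by move=> mD; rewrite -[X in measurable X]setTI; exact: mW.
pose D := `]1, (1 + s)]%classic : set R.
have mD : measurable D by exact: measurable_itv.
set q := (X in 1 - X).
have qD : (q%:E <= P (W @^-1` D))%E.
  rewrite gW// gt_eqF// /normal_prob.
  apply: (@le_trans _ _ (\int[mu]_(x in D) (q / s)%:E)%E).
    rewrite integral_cst//= lebesgue_measure_itv/= lte_fin ltrDl s0 -EFinB -EFinM.
    by rewrite lee_fin addrAC subrr add0r divfK// gt_eqF.
  apply: ge0_le_integral => //.
  - by move=> x _; rewrite lee_fin divr_ge0 ?(ltW s0)// mulr_ge0 ?normal_peak_ge0 ?expR_ge0.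
  - by apply: measurable_funTS; exact: measurable_pdf.
  - move=> x; rewrite /D /= in_itv/= => /andP[x1 x2].
    rewrite lee_fin normal_pdfE ?gt_eqF// /q mulrAC.
    apply: ler_pM.
    + by rewrite divr_ge0 ?normal_peak_ge0 ?ltW.
    + exact: expR_ge0.
    + rewrite /normal_peak expr1n mul1r -mulrnAr sqrtrM ?sqr_ge0// sqrtr_sqr.
      by rewrite (gtr0_norm s0) invfM mulrC.
    + rewrite /normal_fun ler_expR subr0 !mulNr lerN2 ler_pdivrMr; last first.
        by rewrite pmulrn_lgt0// exprn_gt0.
      have -> : (s^-1 + 1) ^+ 2 / 2 * (s ^+ 2 *+ 2) = (1 + s) ^+ 2.
        by field; rewrite gt_eqF.
      by rewrite ler_sqr ?nnegrE//; lra.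
have : (P [set w | (`|W w| <= 1)%R] <= P (~` (W @^-1` D)))%E.
  apply: le_measure; rewrite ?inE.
  - by apply: measurable_set_ler => //; exact: measurableT_comp.
  - by apply: measurableC; exact: mI.
  - move=> w /= w1 ; rewrite /D /= in_itv/= => /andP[w2 _].
    by have := le_lt_trans (le_trans (ler_norm _) w1) w2; rewrite ltxx.
move=> /le_trans; apply; rewrite probability_setC; last exact: mI.
by rewrite EFinB leeB.
Qed.

(** The exponential weight turns the density into a multiple of the normal
    density of variance s^2 / (1 - 2 th s^2). *)
Lemma gaussian_exp_square (W : Omega -> R) (s th : R) : 0 < s -> 0 <= th ->
  2 * th * s ^+ 2 < 1 ->
  measurable_fun setT W -> gaussian_law P W s ->
  (\int[P]_w (expR (th * W w ^+ 2))%:E =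
   ((Num.sqrt (1 - 2 * th * s ^+ 2))^-1)%:E)%E.
Proof.
move=> s0 th0 ths mW gW; set t := 1 - 2 * th * s ^+ 2.
have t0 : 0 < t by rewrite subr_gt0.
have r0 : 0 < Num.sqrt t by rewrite sqrtr_gt0.
have tE : Num.sqrt t ^+ 2 = t by rewrite sqr_sqrtr// ltW.
pose s' := s / Num.sqrt t.
have s'0 : 0 < s' by rewrite divr_gt0.
pose f (x : measurableTypeR R) := (expR (th * x ^+ 2))%:E.
have mf : measurable_fun setT f.
  apply/measurable_EFinP; apply: measurableT_comp => //.
  by apply: measurable_funM => //; exact: measurable_funX.
have mW' : measurable_fun setT (W : Omega -> measurableTypeR R) := mW.
have f0 x : (0 <= f x)%E by rewrite lee_fin expR_ge0.
transitivity (\int[normal_prob 0 s]_x f x)%E.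
  transitivity (\int[pushforward P (W : Omega -> measurableTypeR R)]_x f x)%E.
    by rewrite ge0_integral_pushforward.
  apply: eq_measure_integral => D mD _.
  by rewrite -[LHS]/(P (W @^-1` D)) gW// gt_eqF.
rewrite ge0_integral_normal_prob//.
transitivity (\int[mu]_x ((Num.sqrt t)^-1%:E * (normal_pdf 0 s' x)%:E))%E.
  apply: eq_integral => x _; rewrite /f -!EFinM; congr EFin.
  rewrite !normal_pdfE ?gt_eqF// /normal_peak /normal_fun !subr0.
  have pk u : 0 < u -> Num.sqrt (u ^+ 2 * pi *+ 2) = u * Num.sqrt (pi *+ 2).
    by move=> u0; rewrite -mulrnAr sqrtrM ?sqr_ge0// sqrtr_sqr gtr0_norm.
  have p0 : Num.sqrt (pi *+ 2) != 0 :> R.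
    by rewrite gt_eqF// sqrtr_gt0 pmulrn_lgt0// pi_gt0.
  rewrite !pk// [LHS]mulrCA -expRD [RHS]mulrA; congr (_ * expR _).
    by rewrite /s'; field; rewrite p0 !gt_eqF.
  rewrite /s' expr_div_n tE /t; field.
  by rewrite -/t !gt_eqF.
rewrite ge0_integralZl//.
- by rewrite integral_normal_pdf mule1.
- exact: measurable_pdf.
- by move=> x _; exact: pdf_ge0.
Qed.

End gaussian_estimates.

(** * First passage detected at rational times *)

Section first_passage.
Variable R : realType.
Variables F g : R -> R.
Hypotheses (cF : continuous F) (cg : continuous g).
Hypothesis F0 : F 0 != 0.
Local Notation ratR := (@ratr R).

Lemma le0_of_rational_left (t : R) : 0 < t ->
  (forall q : rat, 0 < ratR q < t -> g (ratR q) <= 0) -> g t <= 0.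
Proof.
move=> t0 hq; rewrite leNgt; apply/negP => gt0.
have /cvgrPdist_lt/(_ _ gt0) := @cg t.
move=> /nbhs_ballP[e /= e0 he].
have lt : Num.max 0 (t - e) < t by rewrite gt_max t0/= ltrBlDr ltrDl.
have [q] := rat_in_itvoo lt; rewrite in_itv/= gt_max => /andP[/andP[q0 qe] qt].
have : `|g t - g (ratR q)| < g t.
  by apply: he; rewrite /ball/= gtr0_norm ?subr_gt0//; lra.
have : g (ratR q) <= 0 by apply: hq; rewrite q0.
by move=> gq; rewrite gtr0_norm; lra.
Qed.

(** F is almost 0 at the rational time q, and g has stayed nonpositive until q.
    This condition involves countably many times only, so that it is measurable
    when F and g depend on a random parameter. *)
Definition rational_passage (K k : nat) (q : rat) : Prop :=
  [/\ 0 < ratR q <= K%:R , `|F (ratR q)| < k.+1%:R^-1 &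
    forall q' : rat, 0 < ratR q' <= ratR q -> g (ratR q') <= 0].

Lemma passage_rational (t : R) : 0 < t -> F t = 0 ->
  (forall u, 0 < u <= t -> g u <= 0) ->
  exists K, forall k, exists q, rational_passage K k q.
Proof.
move=> t0 Ft gle; exists (Num.truncn t).+1 => k.
have tK : t < (Num.truncn t).+1%:R by exact: truncnS_gt.
have k0 : 0 < k.+1%:R^-1 :> R by rewrite invr_gt0.
have /cvgrPdist_lt/(_ _ k0)/nbhs_ballP[e /= e0 he] := @cF t.
have lt : Num.max 0 (t - e) < t by rewrite gt_max t0/= ltrBlDr ltrDl.
have [q] := rat_in_itvoo lt; rewrite in_itv/= gt_max => /andP[/andP[q0 qe] qt].
exists q; split.
- by rewrite q0 (le_trans (ltW qt) (ltW tK)).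
- have := he (ratR q); rewrite Ft sub0r normrN; apply.
  by rewrite /ball/= gtr0_norm ?subr_gt0//; lra.
- by move=> q' /andP[q'0 q'q]; apply: gle; rewrite q'0 (le_trans q'q (ltW qt)).
Qed.

(** The times until which g stays nonpositive form a compact interval, by
    continuity and density of the rational times. As F takes arbitrarily small
    values on it, F vanishes somewhere on it. *)
Lemma rational_passage_zero K :
  (forall k, exists q, rational_passage K k q) ->
  exists2 t : R, 0 < t & F t = 0 /\ forall u, 0 < u <= t -> g u <= 0.
Proof.
move=> hK.
pose E := [set t : R | 0 <= t <= K%:R /\ forall u, 0 < u <= t -> g u <= 0].
have E0 : E 0.
  split; first by rewrite lexx/=.
  by move=> u /andP[u0 /(lt_le_trans u0)]; rewrite ltxx.
have ubE : has_ubound E by exists K%:R => t [/andP[]].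
pose T := sup E.
have T0 : 0 <= T by apply: sup_upper_bound => //; split => //; exists 0.
have gT u : 0 < u <= T -> g u <= 0.
  move=> /andP[u0 uT]; apply: le0_of_rational_left => // q /andP[q0 qu].
  have qT : ratR q < T by exact: lt_le_trans uT.
  have [t [_ gt] qt] := sup_gt (ex_intro _ 0 E0) qT.
  by apply: gt; rewrite q0/= ltW.
have qT K' k q : K' = K -> rational_passage K' k q -> ratR q <= T.
  move=> -> [/andP[q0 qK] _ gq]; apply: sup_upper_bound; first by split=> //; exists 0.
  split; first by rewrite (ltW q0).
  move=> u /andP[u0 uq]; apply: le0_of_rational_left => // q' /andP[q'0 q'u].
  by apply: gq; rewrite q'0 (le_trans (ltW q'u) uq).
have cF' : {within `[0, T], continuous (fun t => `|F t|)}.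
  apply: continuous_subspaceT => t.
  exact: (cvg_comp _ _ (@cF t) (@norm_continuous _ R^o _)).
have [t] := EVT_min T0 cF'; rewrite in_itv/= => /andP[t0 tT] tmin.
have Ft : F t = 0.
  apply/eqP; rewrite -normr_le0; apply/ler_addgt0Pr => e e0; rewrite add0r.
  have [k hk] : exists k, k.+1%:R^-1 < e.
    by have [k] := ltr_add_invr (e0 : 0 < e); rewrite add0r => hk; exists k.
  have [q hq] := hK k; have [/andP[q0 _] Fq _] := hq.
  apply: (le_trans (tmin (ratR q) _)); last by rewrite (le_trans (ltW Fq)) ?ltW.
  by rewrite in_itv/= (ltW q0)/= (qT K k).
exists t.
  rewrite lt_neqAle t0 andbT eq_sym; apply/eqP => tz.
  by move/eqP: F0; apply; move: Ft; rewrite tz.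
by split => // u /andP[u0 ut]; apply: gT; rewrite u0 (le_trans ut tT).
Qed.

Lemma first_zero (t : R) : 0 < t -> F t = 0 ->
  exists2 t0 : R, 0 < t0 & F t0 = 0 /\ forall u, 0 < u -> F u = 0 -> t0 <= u.
Proof.
move=> tp Ft; pose Z := [set u : R | 0 < u /\ F u = 0].
have Zt : Z t by [].
have lbZ : has_lbound Z by exists 0 => u [/ltW].
have hZ : has_inf Z by split=> //; exists t.
have lb u : Z u -> inf Z <= u by move=> Zu; exact: inf_lbound.
have t0ge : 0 <= inf Z by apply: lb_le_inf; [exists t|move=> u [/ltW]].
have Fi : F (inf Z) = 0.
  apply/eqP; apply: contrapT => /negP Fn.
  have : 0 < `|F (inf Z)| by rewrite normr_gt0.
  move=> Fp; have /cvgrPdist_lt/(_ _ Fp)/nbhs_ballP[e /= e0 he] := @cF (inf Z).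
  have [u [u0 Fu] ue] := inf_adherent e0 hZ.
  have hb : ball (inf Z) e u by rewrite /ball/= ler0_norm ?subr_le0 ?lb//; lra.
  by have /= := he _ hb; rewrite Fu subr0 ltxx.
exists (inf Z); last by split => // u u0 Fu; exact: lb.
rewrite lt_neqAle t0ge andbT eq_sym; apply/eqP => tz.
by move/eqP: F0; apply; move: Fi; rewrite tz.
Qed.

End first_passage.

(** * Columns and residual path of the Gaussian linear model *)

Section linear_model_blocks.
Context d (Omega : measurableType d) (R : realType) (P : probability Omega R).
Variables (n p : nat) (sigma : R).
Variables (X : 'I_n -> 'I_p -> {RV P >-> R}) (z : 'I_n -> {RV P >-> R}).
Variable beta : 'cV[R]_p.
Hypothesis model : gaussian_linear_model sigma X z.
Hypothesis n_gt0 : (0 < n)%N.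

Local Notation entry := (linear_model_entries X z).
Local Notation index := ('I_n * 'I_p + 'I_n)%type.

(** For K the set of true columns this is the information that determines the
    residual path. *)
Definition columns_and_noise (K : {set 'I_p}) : {set index} :=
  [set t | if t is inl ij then ij.2 \in K else true].

Definition column_indices (j : 'I_p) : {set index} :=
  [set inl (i, j) | i in [set: 'I_n]]%SET.

Definition row_indices (i : 'I_n) (A : {set 'I_p}) : {set index} :=
  [set inl (i, j) | j in A]%SET.

Definition rows (K : {set 'I_n}) : {set index} :=
  [set t | if t is inl ij then ij.1 \in K else false].

Lemma entry_indep : mutually_independent entry.
Proof. by case: model. Qed.

Lemma entry_gaussian i j : gaussian_law P (X i j) (Num.sqrt n%:R^-1).
Proof. by case: model => h _ _ A mA; exact: h. Qed.

Definition random_column (j : 'I_p) (w : Omega) : 'cV[R]_n := col j (design X w).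

Lemma dot_random_columnE (v : 'cV[R]_n) j w : dot (random_column j w) v =
  \sum_(t in column_indices j) (if t is inl ij then v ij.1 0 else 0) * entry t w.
Proof.
rewrite big_imset/=; last by move=> i i' _ _ [].
apply: eq_big => [i|i _]; first by rewrite inE.
by rewrite !mxE mulrC.
Qed.

(** A column has independent N(0, 1/n) entries, so its correlation with a fixed
    vector v has variance |v|^2 / n. *)
Lemma gaussian_law_dot_column (v : 'cV[R]_n) j :
  gaussian_law P (fun w => dot (random_column j w) v) (Num.sqrt (sqn v / n%:R)).
Proof.
pose a (t : index) : R := if t is inl ij then v ij.1 0 else 0.
have gV t : t \in column_indices j -> gaussian_law P (entry t) (Num.sqrt n%:R^-1).
  by move=> /imsetP[i _ ->]; exact: entry_gaussian.
have := gaussian_law_lincomb entry_indep a (sqrtr_ge0 _) gV.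
rewrite -sqrtrM; last by apply: sumr_ge0 => t _; exact: sqr_ge0.
rewrite big_imset/=; last by move=> i i' _ _ [].
have -> : \sum_(i in [set: 'I_n]%SET) v i 0 ^+ 2 = sqn v.
  by apply: eq_big => [i|i _]; rewrite ?inE// expr2.
rewrite (_ : (fun w => dot (random_column j w) v) =
  (fun w => \sum_(t in column_indices j) a t * entry t w))//.
by apply/funext => w; rewrite dot_random_columnE.
Qed.

Lemma measurable_column_coord (K : {set 'I_p}) i j : j \in K ->
  measurable_fun setT ((fun w => random_column j w i 0) :
    block entry (columns_and_noise K) -> R).
Proof.
move=> jK; rewrite (_ : (fun w => _) = entry (inl (i, j))); last first.
  by apply/funext => w; rewrite !mxE.
by apply: measurable_block_coord; rewrite inE.
Qed.

Lemma measurable_single_column_coord i j :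
  measurable_fun setT ((fun w => random_column j w i 0) :
    block entry (column_indices j) -> R).
Proof.
rewrite (_ : (fun w => _) = entry (inl (i, j))); last first.
  by apply/funext => w; rewrite !mxE.
by apply: measurable_block_coord; apply: imset_f; rewrite inE.
Qed.

Let S : {set 'I_p} := [set j | beta j 0 != 0]%SET.

(** The residual path of the Lasso on the true columns, in the inverse time
    t = 1 / lambda. *)
Definition residual_path (t : R) (w : Omega) : 'cV[R]_n :=
  residual (mask_columns [set j | beta j 0 != 0]%SET (design X w))
    (t *: response X z beta w).

Lemma measurable_response (K : {set 'I_p}) i : S \subset K ->
  measurable_fun setT ((fun w => response X z beta w i 0) :
    block entry (columns_and_noise K) -> R).
Proof.
move=> /fintype.subsetP SK.
rewrite (_ : (fun w => _) = (fun w => \sum_j (if j \in S then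
   beta j 0 * random_column j w i 0 else 0) + entry (inr i) w)); last first.
  apply/funext => w; rewrite !mxE; congr (_ + _); apply: eq_bigr => j _.
  rewrite !mxE; case: ifPn => [_|]; first by rewrite mulrC.
  by rewrite inE negbK => /eqP ->; rewrite mulr0.
apply: measurable_funD; last by apply: measurable_block_coord; rewrite inE.
apply: (@measurable_sum _ _ _ _ _ _
  (fun j (w : block entry (columns_and_noise K)) => if j \in S then
   beta j 0 * random_column j w i 0 else 0)) => j.
case: (boolP (j \in S)) => jS; last exact: measurable_cst.
by apply: measurable_funM => //; apply: measurable_column_coord; exact: SK.
Qed.

Lemma measurable_residual_path (K : {set 'I_p}) t i : S \subset K ->
  measurable_fun setT ((fun w => residual_path t w i 0) :
    block entry (columns_and_noise K) -> R).
Proof.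
move=> SK; apply: (@measurable_residual R n p _ (block entry (columns_and_noise K))).
  move=> i' j; under eq_fun do rewrite mxE.
  case: (boolP (j \in [set j | beta j 0 != 0]%SET)) => jS; last exact: measurable_cst.
  rewrite (_ : (fun w => _) = entry (inl (i', j))); last first.
    by apply/funext => w; rewrite !mxE.
  apply: measurable_block_coord; rewrite inE.
  exact: (fintype.subsetP SK).
move=> i'; under eq_fun do rewrite mxE.
by apply: measurable_funM => //; exact: measurable_response.
Qed.

Lemma measurable_dot d' (T : measurableType d') (f g : T -> 'cV[R]_n) :
  (forall i, measurable_fun setT (fun w => f w i 0)) ->
  (forall i, measurable_fun setT (fun w => g w i 0)) ->
  measurable_fun setT (fun w => dot (f w) (g w)).
Proof.
by move=> mf mg; apply: measurable_sum => i; apply: measurable_funM.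
Qed.

End linear_model_blocks.

(** * Norms of signed sums of columns *)

Section union_bound.
Context d (Omega : measurableType d) (R : realType) (P : probability Omega R).

Lemma union_bound (I : finType) (Q : {set I}) (E : I -> set Omega) (c : R) :
  (forall i, measurable (E i)) -> (forall i, i \in Q -> P (E i) <= c%:E)%E ->
  (P (\bigcup_(i in [set` Q]) E i) <= (#|Q|%:R * c)%:E)%E.
Proof.
move=> mE; move: {2}#|Q| (erefl #|Q|) => m; elim: m Q => [|m IH] Q Qm PE.
  have -> : Q = finset.set0 by apply/eqP; rewrite -cards_eq0 Qm.
  rewrite cards0 mul0r (_ : bigcup _ _ = set0) ?measure0//.
  by apply/seteqP; split => w //= [i /=]; rewrite inE.
have [Q0|[i iQ]] := set_0Vmem Q; first by rewrite Q0 cards0 in Qm.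
have cQ : #|(Q :\ i)%SET| = m by move: Qm; rewrite (cardsD1 i) iQ => -[].
rewrite (_ : bigcup _ _ = E i `|` \bigcup_(k in [set` (Q :\ i)%SET]) E k); last first.
  apply/seteqP; split => w.
    move=> [k /= kQ Ekw]; have [ki|ki] := eqVneq k i; first by left; rewrite -ki.
    by right; exists k => //=; rewrite !inE ki.
  move=> [Eiw|[k /=]]; first by exists i.
  by rewrite !inE => /andP[_ kQ] Ekw; exists k.
apply: le_trans (measureU2 _ (mE i) _) _.
  by apply: fin_bigcup_measurable => //; exact: finite_finset.
apply: (le_trans (leeD (PE i iQ) (IH _ cQ _))).
  by move=> k; rewrite !inE => /andP[_]; exact: PE.
by rewrite -EFinD lee_fin cQ Qm -[in leRHS]add1n natrD mulrDl mul1r.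
Qed.

(** Chernoff's bound: the indicator of c <= W is at most exp (W - c). *)
Lemma exp_chebyshev (W : Omega -> R) (c : R) : measurable_fun setT W ->
  (P [set w | (c <= W w)%R] <= (expR (- c)%R)%:E * \int[P]_w (expR (W w))%:E)%E.
Proof.
move=> mW; pose A := [set w | c <= W w].
have mA : measurable A by exact: measurable_set_ler.
rewrite -ge0_integralZl//; last first.
  by apply/measurable_EFinP; exact: measurableT_comp.
rewrite -[X in P X]setIT -integral_indic//.
apply: ge0_le_integral => //.
- by apply/measurable_EFinP; exact: measurable_indic.
- apply/measurable_EFinP; apply: measurable_funM => //; exact: measurableT_comp.
- move=> w _; rewrite -EFinM lee_fin -expRD indicE.
  have [/set_mem wA|_] := boolP (w \in A); last exact: expR_ge0.
  by rewrite -expR0 ler_expR addrC subr_ge0.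
Qed.

End union_bound.

Section chi_square_rate.
Variable R : realType.
Implicit Type eta : R.

(** A value of the exponent that is small enough for the chi-square moment
    generating function to be finite and for the rate to be below 1. *)
Definition chernoff_exponent eta : R := eta / (4 * (1 + eta)).

(** The bound on the probability that n independent squares of standard normal
    variables have a sum of at least (1 + eta) n is the n-th power of this
    number. *)
Definition chi_square_rate eta : R :=
  (Num.sqrt (1 - 2 * chernoff_exponent eta))^-1 *
  expR (- (chernoff_exponent eta * (1 + eta))).

Lemma chernoff_exponent_bounds eta : 0 < eta ->
  0 < chernoff_exponent eta /\ 2 * chernoff_exponent eta < 1.
Proof.
move=> e0; rewrite /chernoff_exponent; split; first by rewrite divr_gt0//; lra.
rewrite mulrA ltr_pdivrMr; lra.
Qed.

(** After squaring, the inequality reads exp (- eta / 2) < 1 - 2 k for the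
    exponent k, and follows from exp x >= 1 + x. *)
Lemma chi_square_rate_lt1 eta : 0 < eta -> 0 < chi_square_rate eta < 1.
Proof.
move=> e0; have [k0 k1] := chernoff_exponent_bounds e0.
have t0 : 0 < 1 - 2 * chernoff_exponent eta by rewrite subr_gt0.
rewrite /chi_square_rate mulr_gt0 ?expR_gt0 ?invr_gt0 ?sqrtr_gt0//=.
rewrite mulrC ltr_pdivrMr ?sqrtr_gt0// mul1r.
rewrite -ltr_sqr ?nnegrE ?sqrtr_ge0 ?expR_ge0// sqr_sqrtr ?(ltW t0)//.
rewrite -expRM_natl.
have -> : 2 * - (chernoff_exponent eta * (1 + eta)) = - (eta / 2).
  by rewrite /chernoff_exponent; field; lra.
rewrite expRN.
have h : 1 + eta / 2 <= expR (eta / 2) by exact: expR_ge1Dx.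
have h0 : 0 < 1 + eta / 2 by lra.
apply: (@le_lt_trans _ _ (1 + eta / 2)^-1).
  by rewrite lef_pV2 ?posrE ?expR_gt0.
rewrite invf_plt ?posrE// /chernoff_exponent.
have -> : 1 - 2 * (eta / (4 * (1 + eta))) = (2 + eta) / (2 * (1 + eta)).
  by field; lra.
rewrite invf_div ltr_pdivrMr; last by lra.
have : 0 < eta * eta by rewrite mulr_gt0.
lra.
Qed.

End chi_square_rate.

Section signed_column_sums.
Context d (Omega : measurableType d) (R : realType) (P : probability Omega R).
Variables (n p : nat) (sigma : R).
Variables (X : 'I_n -> 'I_p -> {RV P >-> R}) (z : 'I_n -> {RV P >-> R}).
Hypothesis model : gaussian_linear_model sigma X z.
Hypothesis n_gt0 : (0 < n)%N.

Local Notation entry := (linear_model_entries X z).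
Local Notation index := ('I_n * 'I_p + 'I_n)%type.

Implicit Types A B : {set 'I_p}.

Definition sign_of (B : {set 'I_p}) (j : 'I_p) : R := if j \in B then -1 else 1.

(** The image under the design of the vector of signs supported by A that is -1
    on B. Only the lengths of these finitely many vectors matter in
    [touching_norm], which makes a union bound over A and B possible. *)
Definition signed_sum (A B : {set 'I_p}) (w : Omega) : 'cV[R]_n :=
  \sum_(j in A) sign_of B j *: random_column X j w.

Lemma signed_sum_coordE A B w i : signed_sum A B w i 0 =
  \sum_(t in row_indices i A) (if t is inl ij then sign_of B ij.2 else 0) * entry t w.
Proof.
rewrite /signed_sum summxE big_imset/=; last by move=> j j' _ _ [].
by apply: eq_bigr => j _; rewrite !mxE.
Qed.

Lemma gaussian_law_signed_sum A B i :
  gaussian_law P (fun w => signed_sum A B w i 0) (Num.sqrt (#|A|%:R / n%:R)).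
Proof.
pose a (t : index) : R := if t is inl ij then sign_of B ij.2 else 0.
have gV t : t \in row_indices i A -> gaussian_law P (entry t) (Num.sqrt n%:R^-1).
  by move=> /imsetP[j _ ->]; exact: (entry_gaussian model).
have := gaussian_law_lincomb (entry_indep model) a (sqrtr_ge0 _) gV.
rewrite -sqrtrM; last by apply: sumr_ge0 => t _; exact: sqr_ge0.
rewrite big_imset/=; last by move=> j j' _ _ [].
have -> : \sum_(j in A) sign_of B j ^+ 2 = #|A|%:R.
  rewrite -sum1_card natr_sum; apply: eq_bigr => j _.
  by rewrite /sign_of; case: ifP => _; rewrite ?sqrrN expr1n.
rewrite (_ : (fun w => signed_sum A B w i 0) =
  (fun w => \sum_(t in row_indices i A) a t * entry t w))//.
by apply/funext => w; rewrite signed_sum_coordE.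
Qed.

Lemma measurable_signed_sum_rows A B (K : {set 'I_n}) i : i \in K ->
  measurable_fun setT ((fun w => signed_sum A B w i 0) : block entry (rows p K) -> R).
Proof.
move=> iK; rewrite (_ : (fun w => _) =
  (fun w => \sum_(t in row_indices i A)
   (if t is inl ij then sign_of B ij.2 else 0) * entry t w)); last first.
  by apply/funext => w; rewrite signed_sum_coordE.
apply: measurable_block_lincomb; apply/fintype.subsetP => t /imsetP[j _ ->].
by rewrite inE.
Qed.

Lemma measurable_signed_sum_columns (S : {set 'I_p}) A B i : A \subset S ->
  measurable_fun setT ((fun w => signed_sum A B w i 0) :
    block entry (columns_and_noise n S) -> R).
Proof.
move=> /fintype.subsetP AS; rewrite (_ : (fun w => _) =
  (fun w => \sum_(t in row_indices i A)
   (if t is inl ij then sign_of B ij.2 else 0) * entry t w)); last first.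
  by apply/funext => w; rewrite signed_sum_coordE.
apply: measurable_block_lincomb; apply/fintype.subsetP => t /imsetP[j jA ->].
by rewrite inE; exact: AS.
Qed.

(** The coordinates of a signed sum belong to disjoint rows of the design; the
    moment generating function of the sum of their squares factorizes. *)
Lemma integral_exp_rows A B (th : R) (K : {set 'I_n}) : (0 < #|A|)%N -> 0 <= th ->
  2 * th * (#|A|%:R / n%:R) < 1 ->
  (\int[P]_w (expR (th * \sum_(i in K) signed_sum A B w i 0 ^+ 2))%:E =
   ((Num.sqrt (1 - 2 * th * (#|A|%:R / n%:R)))^-1 ^+ #|K|)%:E)%E.
Proof.
move=> A0 th0 th1.
have s20 : 0 < #|A|%:R / n%:R :> R by rewrite divr_gt0 ?ltr0n.
move: {2}#|K| (erefl #|K|) => m; elim: m K => [|m IH] K Km.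
  have -> : K = finset.set0 by apply/eqP; rewrite -cards_eq0 Km.
  under eq_integral do rewrite big_set0 mulr0 expR0.
  rewrite cards0 expr0 integral_cst// mul1e; exact: probability_setT.
have [K0|[i iK]] := set_0Vmem K; first by rewrite K0 cards0 in Km.
have cK : #|(K :\ i)%SET| = m by move: Km; rewrite (cardsD1 i) iK => -[].
pose f w := (expR (th * \sum_(k in (K :\ i)%SET) signed_sum A B w k 0 ^+ 2))%:E.
pose g w := (expR (th * signed_sum A B w i 0 ^+ 2))%:E.
transitivity (\int[P]_w (f w * g w))%E.
  apply: eq_integral => w _; rewrite /f /g -EFinM -expRD -mulrDr.
  by rewrite (big_setD1 i iK)/= addrC.
rewrite (@block_ge0_integralM _ _ _ P _ entry (entry_indep model)
  (rows p (K :\ i)%SET) (rows p [set i]%SET) _ f g).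
- rewrite IH// cK Km exprSr EFinM; congr (_ * _)%E.
  rewrite /g (@gaussian_exp_square _ _ _ P _ (Num.sqrt (#|A|%:R / n%:R)))//.
  + by rewrite sqr_sqrtr// ltW.
  + by rewrite sqrtr_gt0.
  + by rewrite sqr_sqrtr// ltW.
  + have := @measurable_signed_sum_rows A B [set i]%SET i.
    by move=> /(_ _)/measurable_block_fun; apply; rewrite inE.
  + exact: gaussian_law_signed_sum.
- by move=> [[k j]|k]; rewrite !inE//= => /andP[/negbTE ->].
- apply/measurable_EFinP; apply: measurableT_comp => //.
  apply: measurable_funM => //.
  rewrite (_ : (fun w => _) = (fun w => \sum_k
    if k \in (K :\ i)%SET then signed_sum A B w k 0 ^+ 2 else 0)); last first.
    by apply/funext => w; rewrite big_mkcond.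
  apply: (@measurable_sum _ _ _ _ _ _ (fun k (w : block entry (rows p (K :\ i)%SET)) =>
    if k \in (K :\ i)%SET then signed_sum A B w k 0 ^+ 2 else 0)) => k.
  case: (boolP (k \in (K :\ i)%SET)) => kK; last exact: measurable_cst.
  by apply: measurable_funX; exact: measurable_signed_sum_rows.
- apply/measurable_EFinP; apply: measurableT_comp => //.
  apply: measurable_funM => //; apply: measurable_funX.
  by apply: measurable_signed_sum_rows; rewrite inE.
- by move=> w; rewrite lee_fin expR_ge0.
- by move=> w; rewrite lee_fin expR_ge0.
Qed.

End signed_column_sums.

Section norm_event.
Context d (Omega : measurableType d) (R : realType) (P : probability Omega R).
Variables (n p : nat) (sigma : R).
Variables (X : 'I_n -> 'I_p -> {RV P >-> R}) (z : 'I_n -> {RV P >-> R}).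
Hypothesis model : gaussian_linear_model sigma X z.
Hypothesis n_gt0 : (0 < n)%N.
Local Notation entry := (linear_model_entries X z).
Implicit Types A B S : {set 'I_p}.

Lemma measurable_signed_sum A B i :
  measurable_fun setT (fun w => signed_sum X A B w i 0).
Proof.
apply: (@measurable_block_fun _ _ _ P _ entry (columns_and_noise n A)).
exact: measurable_signed_sum_columns.
Qed.

Lemma chi_square_tail A B (eta : R) : (0 < #|A|)%N -> 0 < eta ->
  (P [set w | ((1 + eta) * #|A|%:R <= sqn (signed_sum X A B w))%R]
    <= (chi_square_rate eta ^+ n)%:E)%E.
Proof.
move=> A0 e0; have [k0 k1] := chernoff_exponent_bounds e0.
set k := chernoff_exponent eta in k0 k1.
have n0 : 0 < n%:R :> R by rewrite ltr0n.
have a0 : 0 < #|A|%:R :> R by rewrite ltr0n.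
pose th := k * n%:R / #|A|%:R.
have th0 : 0 < th by rewrite divr_gt0// mulr_gt0.
have thE : 2 * th * (#|A|%:R / n%:R) = 2 * k.
  by rewrite /th; field; rewrite !gt_eqF.
pose W w := th * \sum_(i in [set: 'I_n]%SET) signed_sum X A B w i 0 ^+ 2.
have WE w : W w = th * sqn (signed_sum X A B w).
  by congr (_ * _); apply: eq_big => [i|i _]; rewrite ?inE// expr2.
have mW : measurable_fun setT W.
  rewrite (_ : W = (fun w => th * sqn (signed_sum X A B w))); last first.
    by apply/funext => w; rewrite WE.
  apply: measurable_funM => //; apply: measurable_sum => i.
  by apply: measurable_funM => //; exact: measurable_signed_sum.
rewrite (_ : [set w | _] = [set w | th * ((1 + eta) * #|A|%:R) <= W w]); last first.
  by apply/seteqP; split => w /=; rewrite WE ler_pM2l.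
apply: (le_trans (exp_chebyshev P _ mW)).
rewrite (integral_exp_rows model n_gt0 B _ A0 (ltW th0)); last by rewrite thE.
rewrite thE -EFinM lee_fin cardsT card_ord /chi_square_rate -/k exprMn mulrC.
rewrite ler_wpM2l ?exprn_ge0 ?invr_ge0 ?sqrtr_ge0// -expRM_natl ler_expR.
rewrite mulrN lerN2 le_eqVlt; apply/orP; left; apply/eqP.
by rewrite /th; field; rewrite gt_eqF.
Qed.

Definition large_signed_sum S (s : nat) (eta : R) : set Omega :=
  \bigcup_(AB in [set` [set AB : {set 'I_p} * {set 'I_p} |
      [&& AB.1 \subset S, #|AB.1| == s & AB.2 \subset AB.1]]%SET])
    [set w | (1 + eta) * #|AB.1|%:R <= sqn (signed_sum X AB.1 AB.2 w)].

(** There are at most C(p, s) choices of A and 2 ^ s choices of the signs. *)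
Lemma card_signed_subsets S (s : nat) :
  (#|[set AB : {set 'I_p} * {set 'I_p} |
      [&& AB.1 \subset S, #|AB.1| == s & AB.2 \subset AB.1]]%SET|
    <= 'C(p, s) * 2 ^ s)%N.
Proof.
rewrite -sum1_card.
rewrite (eq_bigl (fun AB : {set 'I_p} * {set 'I_p} =>
   ((AB.1 \subset S) && (#|AB.1| == s)) && (AB.2 \subset AB.1))); last first.
  by move=> AB; rewrite inE andbA.
rewrite -(pair_big_dep (fun A => (A \subset S) && (#|A| == s))
  (fun A B => B \subset A) (fun _ _ => 1%N))/=.
rewrite (eq_bigr (fun=> 2 ^ s)%N); last first.
  move=> A /andP[_ /eqP <-]; rewrite -card_powerset -sum1_card.
  by apply: eq_bigl => B; rewrite inE.
rewrite sum_nat_const leq_mul2r; apply/orP; right.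
rewrite -[X in 'C(X, _)]card_ord -card_draws subset_leq_card//.
by apply/fintype.subsetP => A; rewrite inE => /andP[].
Qed.

Lemma measurable_large_signed_sum_block S (s : nat) (eta : R) :
  measurable (large_signed_sum S s eta : set (block entry (columns_and_noise n S))).
Proof.
apply: fin_bigcup_measurable; first exact: finite_finset.
move=> [A B] /=; rewrite inE /= => /and3P[AS _ _].
apply: measurable_set_ler => //; apply: measurable_sum => i.
by apply: measurable_funM; exact: measurable_signed_sum_columns.
Qed.

Lemma large_signed_sum_le S (s : nat) (eta : R) : (0 < s)%N -> 0 < eta ->
  (P (large_signed_sum S s eta) <= (('C(p, s) * 2 ^ s)%:R * chi_square_rate eta ^+ n)%:E)%E.
Proof.
move=> s0 e0.
apply: (le_trans (union_bound (c := chi_square_rate eta ^+ n) _ _)).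
- move=> AB; apply: measurable_set_ler => //; apply: measurable_sum => i.
  by apply: measurable_funM; exact: measurable_signed_sum.
- move=> [A B]; rewrite inE /= => /and3P[_ /eqP As _].
  by apply: chi_square_tail => //; rewrite As.
rewrite lee_fin ler_wpM2r ?ler_nat ?card_signed_subsets// exprn_ge0// ltW//.
by have /andP[] := chi_square_rate_lt1 e0.
Qed.

(** If |x_j^T v| = 1 for the s columns in A, then pairing v with the sum of these
    columns, signed as x_j^T v, gives exactly s. Cauchy-Schwarz yields
    s^2 <= |signed sum|^2 |v|^2 <= (1 + eta) s |v|^2. *)
Lemma touching_norm S (s : nat) (eta : R) A w (v : 'cV[R]_n) : 0 < eta ->
  (0 < s)%N -> A \subset S -> #|A| = s -> ~ large_signed_sum S s eta w ->
  (forall j, j \in A -> `|dot (random_column X j w) v| = 1) ->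
  s%:R <= (1 + eta) * sqn v.
Proof.
move=> e0 s0 AS As nlarge touch.
pose B := [set j in A | dot (random_column X j w) v < 0]%SET.
have BA : B \subset A by apply/fintype.subsetP => j; rewrite inE => /andP[].
have Ys : sqn (signed_sum X A B w) <= (1 + eta) * s%:R.
  rewrite leNgt; apply/negP => h; apply: nlarge; exists (A, B).
    by rewrite /= inE /= AS As eqxx BA.
  by rewrite /= As ltW.
have dotE : dot (signed_sum X A B w) v = s%:R.
  rewrite /dot; under eq_bigr do rewrite summxE mulr_suml.
  rewrite exchange_big/= -As -sum1_card natr_sum; apply: eq_bigr => j jA.
  transitivity (sign_of R B j * dot (random_column X j w) v).
    by rewrite /dot mulr_sumr; apply: eq_bigr => i _; rewrite mxE mulrA.
  have := touch j jA; rewrite /sign_of inE jA /=.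
  case: ltrP => h; first by rewrite ltr0_norm// mulN1r.
  by rewrite ger0_norm// mul1r.
have s1 : 0 < s%:R :> R by rewrite ltr0n.
have := CauchySchwarz_dot (signed_sum X A B w) v; rewrite dotE => cs.
have : s%:R * s%:R <= s%:R * ((1 + eta) * sqn v).
  rewrite -expr2 (le_trans cs)// (le_trans (ler_wpM2r (dot_ge0 v) Ys))//.
  by rewrite mulrAC mulrC.
by rewrite ler_pM2l.
Qed.

End norm_event.

(** * Simultaneous touches by two false columns *)

Section ties.
Context d (Omega : measurableType d) (R : realType) (P : probability Omega R).
Variables (n p : nat) (sigma : R).
Variables (X : 'I_n -> 'I_p -> {RV P >-> R}) (z : 'I_n -> {RV P >-> R}).
Variable beta : 'cV[R]_p.
Hypothesis model : gaussian_linear_model sigma X z.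
Hypothesis n_gt0 : (0 < n)%N.
Local Notation entry := (linear_model_entries X z).
Local Notation S := [set j | beta j 0 != 0]%SET.
Local Notation u := (residual_path X z beta).
Local Notation x := (random_column X).

Lemma columns_disjoint (K : {set 'I_p}) j t : j \notin K ->
  t \in columns_and_noise n K -> t \notin column_indices n j.
Proof.
move=> jK; rewrite inE => tK; apply/negP => /imsetP[i _ tE].
by move: tK jK; rewrite tE /= => ->.
Qed.

Lemma measurable_dot_path (K : {set 'I_p}) j t : S \subset K -> j \in K ->
  measurable_fun setT ((fun w => dot (x j w) (u t w)) :
    block entry (columns_and_noise n K) -> R).
Proof.
move=> SK jK; apply: measurable_dot => i; first exact: measurable_column_coord.
exact: measurable_residual_path.
Qed.

Definition near_touch (t e : R) (j : 'I_p) : set Omega :=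
  [set w | `| `|dot (x j w) (u t w)| - 1| <= e].

Lemma measurable_near_touch (K : {set 'I_p}) j t e : S \subset K -> j \in K ->
  measurable (near_touch t e j : set (block entry (columns_and_noise n K))).
Proof.
move=> SK jK; apply: measurable_set_ler => //; apply: measurableT_comp => //.
apply: measurable_funB => //; apply: measurableT_comp => //.
exact: measurable_dot_path.
Qed.

(** Given the columns in K and the noise, the residual is a fixed vector of
    squared norm at least c, and its correlation with the fresh column j is a
    normal variable of standard deviation at least sqrt (c / n). *)
Lemma near_touch_bound (K : {set 'I_p}) j t e c
    (A : set (block entry (columns_and_noise n K))) :
  S \subset K -> j \notin K -> 0 <= e -> 0 < c -> measurable A ->
  (forall w, A w -> c <= sqn (u t w)) ->
  (P (A `&` near_touch t e j) <= (4 * e / Num.sqrt (c / n%:R))%:E * P A)%E.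
Proof.
move=> SK jK e0 c0 mA Ac; have n0 : 0 < n%:R :> R by rewrite ltr0n.
pose C := [set y : block entry (columns_and_noise n K) * block entry (column_indices n j) |
  `| `|dot (x j y.2) (u t y.1)| - 1| <= e].
have mC : measurable C.
  apply: measurable_set_ler => //; apply: measurableT_comp => //.
  apply: measurable_funB => //; apply: measurableT_comp => //.
  apply: measurable_dot => i.
    have h : measurable_fun setT
        ((fun w' => x j w' i 0) : block entry (column_indices n j) -> R).
      exact: measurable_single_column_coord.
    exact: (measurableT_comp h measurable_snd).
  have h : measurable_fun setT
      ((fun w' => u t w' i 0) : block entry (columns_and_noise n K) -> R).
    exact: measurable_residual_path.
  exact: (measurableT_comp h measurable_fst).
have cn : 0 < c / n%:R by rewrite divr_gt0.
apply: (section_bound (entry_indep model) _ mA mC).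
- by move=> k kK; exact: (columns_disjoint jK kK).
- by rewrite divr_ge0 ?sqrtr_ge0 ?mulr_ge0.
move=> w Aw.
have v0 : c <= sqn (u t w) := Ac w Aw.
have s0 : 0 < Num.sqrt (sqn (u t w) / n%:R).
  by rewrite sqrtr_gt0 divr_gt0// (lt_le_trans c0).
rewrite (_ : xsection C w = [set w' | `| `|dot (x j w') (u t w)| - 1| <= e]); last first.
  by apply/seteqP; split => w' /=; rewrite /xsection/= inE.
apply: (le_trans (gaussian_near_one s0 e0 _ (gaussian_law_dot_column model (u t w) j))).
  apply: measurable_dot => i; last exact: measurable_cst.
  apply: (@measurable_block_fun _ _ _ P _ entry (column_indices n j)).
  exact: measurable_single_column_coord.
rewrite lee_fin ler_wpM2l ?mulr_ge0// lef_pV2 ?posrE ?sqrtr_gt0//.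
  by rewrite ler_wsqrtr// ler_wpM2r// invr_ge0 ltW.
by rewrite divr_gt0// (lt_le_trans c0).
Qed.

(** Conditioning successively on the two columns multiplies the bounds. The
    square is essential: it beats the number of points of a time grid. *)
Lemma double_near_touch_bound j k t e c : j \notin S -> k \notin S -> j != k ->
  0 <= e -> 0 < c ->
  (P ([set w | (c <= sqn (u t w))%R] `&` near_touch t e j `&` near_touch t e k) <=
    ((4 * e / Num.sqrt (c / n%:R)) ^+ 2)%:E)%E.
Proof.
move=> jS kS jk e0 c0.
pose A0 := [set w | c <= sqn (u t w)].
have mA0 : measurable (A0 : set (block entry (columns_and_noise n S))).
  apply: measurable_set_ler => //.
  by apply: measurable_dot => i; exact: measurable_residual_path.
have q0 : 0 <= 4 * e / Num.sqrt (c / n%:R) by rewrite divr_ge0 ?sqrtr_ge0 ?mulr_ge0.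
have SK : S \subset (j |: S)%SET by exact: finset.subsetUr.
have mA1 : measurable ((A0 `&` near_touch t e j) :
    set (block entry (columns_and_noise n (j |: S)%SET))).
  apply: measurableI; last by apply: measurable_near_touch => //; rewrite setU11.
  apply: measurable_set_ler => //.
  by apply: measurable_dot => i; exact: measurable_residual_path.
have kK : k \notin (j |: S)%SET by rewrite in_setU1 negb_or eq_sym jk.
apply: (le_trans (near_touch_bound SK kK e0 c0 mA1 _)); first by move=> w [].
rewrite expr2 [leRHS]EFinM lee_wpmul2l ?lee_fin//.
apply: (le_trans (near_touch_bound (subxx S) jS e0 c0 mA0 _)); first by move=> w.
rewrite -[leRHS]mule1 lee_wpmul2l ?lee_fin//.
by apply: probability_le1; exact: measurable_block mA0.
Qed.

Definition bounded_tie (M : nat) (j k : 'I_p) : set Omega :=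
  [set w | [/\ sqn (x j w) <= M%:R ^+ 2, sqn (x k w) <= M%:R ^+ 2,
    sqn (response X z beta w) <= M%:R ^+ 2 &
    exists2 t, 0 < t <= M%:R & `|dot (x j w) (u t w)| = 1 /\ `|dot (x k w) (u t w)| = 1]].

(** A grid of N + 1 times in [0, M]. The path moves by at most M / N times the
    norm of the response between neighbouring times, so that an exact touch at
    some time is a touch up to M^3 / N at a grid time, where moreover the
    residual cannot be small. *)
Definition tie_cover (M N : nat) (j k : 'I_p) : set Omega :=
  \bigcup_(i in [set` [set: 'I_N.+1]%SET])
    ([set w | (4 * M%:R ^+ 2)^-1 <= sqn (u (M%:R * i%:R / N%:R) w)] `&`
     near_touch (M%:R * i%:R / N%:R) (M%:R ^+ 3 / N%:R) j `&`
     near_touch (M%:R * i%:R / N%:R) (M%:R ^+ 3 / N%:R) k).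

Lemma bounded_tie_cover M N j k : (0 < M)%N -> (2 * M ^ 3 < N)%N ->
  bounded_tie M j k `<=` tie_cover M N j k.
Proof.
move=> M0 MN w [xj xk y [t /andP[t0 tM] [tj tk]]].
have m0 : 0 < M%:R :> R by rewrite ltr0n.
have N0 : 0 < N%:R :> R by rewrite ltr0n (leq_ltn_trans _ MN).
have e2 : M%:R ^+ 3 / N%:R <= 2^-1 :> R.
  have : 2 * M%:R ^+ 3 <= N%:R :> R by rewrite -natrX -natrM ler_nat ltnW.
  by rewrite ler_pdivrMr//; lra.
pose i := Num.truncn (t * N%:R / M%:R).
have r0 : 0 <= t * N%:R / M%:R by rewrite divr_ge0 ?mulr_ge0 ?ltW.
have /andP[i1 i2] : i%:R <= t * N%:R / M%:R < i.+1%:R by exact: truncn_itv.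
have iN : (i < N.+1)%N.
  rewrite ltnS -(ler_nat R) (le_trans i1)// ler_pdivrMr// [leLHS]mulrC.
  by rewrite ler_wpM2l ?(ltW N0).
set ti := M%:R * i%:R / N%:R : R.
have tti : `|t - ti| <= M%:R / N%:R.
  have h1 : ti <= t by rewrite /ti ler_pdivrMr// [leLHS]mulrC -ler_pdivlMr.
  have h2 : t <= ti + M%:R / N%:R.
    rewrite /ti -mulrDl ler_pdivlMr// -[X in _ + X]mulr1 -mulrDr natr1.
    by rewrite [leRHS]mulrC -ler_pdivrMr// ltW.
  by rewrite ger0_norm ?subr_ge0//; lra.
have close l : sqn (x l w) <= M%:R ^+ 2 ->
    `|dot (x l w) (u t w) - dot (x l w) (u ti w)| <= M%:R ^+ 3 / N%:R.
  move=> xl; apply: (le_trans (dot_residual_lipschitz _ _ _ _ _)).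
  have : Num.sqrt (sqn (x l w) * sqn (response X z beta w)) <= M%:R ^+ 2.
    rewrite -[leRHS]ger0_norm ?sqr_ge0// -sqrtr_sqr ler_wsqrtr//.
    by rewrite [leRHS]expr2 ler_pM ?dot_ge0.
  move=> h; apply: (le_trans (ler_pM (sqrtr_ge0 _) (normr_ge0 _) h tti)).
  by rewrite mulrA -exprSr.
have near_of l : sqn (x l w) <= M%:R ^+ 2 -> `|dot (x l w) (u t w)| = 1 ->
    near_touch ti (M%:R ^+ 3 / N%:R) l w.
  move=> xl tl; rewrite /near_touch/= -[X in _ - X]tl.
  by rewrite distrC (le_trans (ler_dist_dist _ _))// close.
exists (Ordinal iN) => /=; first by rewrite inE.
rewrite -/ti; split; [split|]; [|exact: near_of|exact: near_of].
have ge12 : 2^-1 <= `|dot (x j w) (u ti w)|.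
  have := near_of j xj tj; rewrite /near_touch/= ler_norml => /andP[h _].
  by move: e2 h; lra.
have h := CauchySchwarz_dot (x j w) (u ti w).
have h2 : 2^-1 ^+ 2 <= dot (x j w) (u ti w) ^+ 2.
  by rewrite -[leRHS]ger0_norm ?sqr_ge0// normrX ler_sqr ?nnegrE.
have h3 : 4^-1 <= M%:R ^+ 2 * sqn (u ti w).
  apply: le_trans (_ : 2^-1 ^+ 2 <= _); first by rewrite exprVn lef_pV2 ?posrE//; lra.
  apply: (le_trans h2); apply: (le_trans h); exact: (ler_wpM2r (dot_ge0 _) xj).
have m2 : 0 < 4 * M%:R ^+ 2 :> R by rewrite mulr_gt0 ?exprn_gt0.
by rewrite /= -[leLHS]mul1r ler_pdivrMr//; lra.
Qed.

Lemma measurable_near_touch_event t e j : measurable (near_touch t e j : set Omega).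
Proof.
apply: (@measurable_block _ _ _ P _ entry (columns_and_noise n (j |: S)%SET)).
by apply: measurable_near_touch; [exact: finset.subsetUr|rewrite setU11].
Qed.

Lemma measurable_sqn_path t : measurable_fun setT (fun w => sqn (u t w)).
Proof.
apply: (@measurable_block_fun _ _ _ P _ entry (columns_and_noise n S)).
by apply: measurable_dot => i; exact: measurable_residual_path.
Qed.

Lemma measurable_tie_cover M N j k : measurable (tie_cover M N j k).
Proof.
apply: fin_bigcup_measurable; first exact: finite_finset.
move=> i _; apply: measurableI; last exact: measurable_near_touch_event.
apply: measurableI; last exact: measurable_near_touch_event.
by apply: measurable_set_ler => //; exact: measurable_sqn_path.
Qed.

Lemma tie_cover_le M N j k : (0 < M)%N -> (0 < N)%N ->
  j \notin S -> k \notin S -> j != k ->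
  (P (tie_cover M N j k) <= (128 * M%:R ^+ 8 * n%:R / N%:R)%:E)%E.
Proof.
move=> M0 N0 jS kS jk.
have m0 : 0 < M%:R :> R by rewrite ltr0n.
have n0 : 0 < n%:R :> R by rewrite ltr0n.
have N0' : 0 < N%:R :> R by rewrite ltr0n.
have c0 : 0 < (4 * M%:R ^+ 2)^-1 :> R by rewrite invr_gt0 mulr_gt0 ?exprn_gt0.
have e0 : 0 <= M%:R ^+ 3 / N%:R :> R by rewrite divr_ge0 ?exprn_ge0.
apply: le_trans (union_bound (c := 64 * M%:R ^+ 8 * n%:R / N%:R ^+ 2) _ _) _.
- move=> i; apply: measurableI; last exact: measurable_near_touch_event.
  apply: measurableI; last exact: measurable_near_touch_event.
  by apply: measurable_set_ler => //; exact: measurable_sqn_path.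
- move=> i _; apply: le_trans (double_near_touch_bound _ jS kS jk e0 c0) _.
  rewrite lee_fin expr_div_n sqr_sqrtr ?divr_ge0 ?(ltW c0)//.
  rewrite le_eqVlt; apply/orP; left; apply/eqP; field.
  by rewrite !gt_eqF.
rewrite cardsT card_ord lee_fin -natr1.
have N1 : 1 <= N%:R :> R by rewrite ler1n.
have -> : 128 * M%:R ^+ 8 * n%:R / N%:R =
    (2 * N%:R) * (64 * M%:R ^+ 8 * n%:R / N%:R ^+ 2) :> R.
  by field; rewrite gt_eqF.
rewrite ler_wpM2r; last by lra.
  by [].
by rewrite divr_ge0 ?mulr_ge0 ?exprn_ge0.
Qed.

(** The grid has N + 1 points and each of them costs a probability of order
    N^-2, so that the total is of order 1 / N. *)
Lemma bounded_tie_negligible M j k : j \notin S -> k \notin S -> j != k ->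
  P.-negligible (bounded_tie M j k).
Proof.
move=> jS kS jk; case: (posnP M) => [->|M0].
  rewrite (_ : bounded_tie 0 j k = set0); first exact: negligible_set0.
  apply/seteqP; split => w //= -[_ _ _ [t /andP[t0 tM] _]].
  by have := lt_le_trans t0 tM; rewrite ltxx.
pose A := \bigcap_N tie_cover M (N + (2 * M ^ 3).+1) j k.
have mA : measurable A by apply: bigcapT_measurable => N; exact: measurable_tie_cover.
exists A; split => //; last first.
  by move=> w hw N _; apply: bounded_tie_cover hw => //; rewrite addnS ltnS leq_addl.
apply/eqP; rewrite eq_le measure_ge0 andbT.
apply/lee_addgt0Pr => e e0; rewrite add0e.
set K : R := 128 * M%:R ^+ 8 * n%:R.
have K0 : 0 <= K by rewrite !mulr_ge0 ?exprn_ge0.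
pose N := (Num.truncn (K / e)).+1.
have NK : K / e < N%:R by exact: truncnS_gt.
set N' := (N + (2 * M ^ 3).+1)%N.
have N'0 : (0 < N')%N by rewrite /N' addnS.
apply: (@le_trans _ _ (P (tie_cover M N' j k))).
  apply: le_measure; rewrite ?inE//; first exact: measurable_tie_cover.
  by move=> w /(_ N I).
apply: (le_trans (tie_cover_le M0 N'0 jS kS jk)).
rewrite lee_fin -/K ler_pdivrMr ?ltr0n//.
have : K <= e * N%:R by rewrite mulrC -ler_pdivrMr// ltW.
move=> /le_trans; apply; rewrite ler_wpM2l ?(ltW e0)// ler_nat.
exact: leq_addr.
Qed.

Definition tie (j k : 'I_p) : set Omega := [set w | exists2 t, 0 < t &
  `|dot (x j w) (u t w)| = 1 /\ `|dot (x k w) (u t w)| = 1].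

(** Almost surely two false columns are never touched at the same time: neither
    of them has been used to build the path. This argument covers degenerate
    situations, such as a column that is touched without being selected, in
    which the path gives no information on the order of selection. *)
Lemma tie_negligible : exists N : set Omega, [/\ measurable N, P N = 0%E &
  forall j k, j \notin S -> k \notin S -> j != k -> tie j k `<=` N].
Proof.
pose F (i : nat) : set Omega := if @unpickle (nat * 'I_p * 'I_p)%type i is Some (M, j, k)
  then if [&& j \notin S, k \notin S & j != k] then bounded_tie M j k else set0
  else set0.
have : P.-negligible (\bigcup_i F i).
  apply: negligible_bigcup => i; rewrite /F; case: unpickle => [[[M j] k]|].
    case: ifP => [/and3P[jS kS jk]|_]; last exact: negligible_set0.
    exact: bounded_tie_negligible.
  exact: negligible_set0.
move=> [N [mN N0 FN]]; exists N; split => // j k jS kS jk w [t t0 [tj tk]].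
apply: FN.
pose T := t + sqn (x j w) + sqn (x k w) + sqn (response X z beta w) + 1.
have d1 := dot_ge0 (x j w); have d2 := dot_ge0 (x k w).
have d3 := dot_ge0 (response X z beta w).
have T1 : 1 <= T by rewrite /T; lra.
pose M := (Num.truncn T).+1.
have TM : T < M%:R by exact: truncnS_gt.
have MM : M%:R <= M%:R ^+ 2 :> R by rewrite expr2 ler_peMl//; lra.
exists (pickle (M, j, k)) => //; rewrite /F pickleK jS kS jk /=.
split.
- by rewrite (le_trans _ MM)// (le_trans _ (ltW TM))// /T; lra.
- by rewrite (le_trans _ MM)// (le_trans _ (ltW TM))// /T; lra.
- by rewrite (le_trans _ MM)// (le_trans _ (ltW TM))// /T; lra.
- exists t => //; rewrite t0/= (le_trans _ (ltW TM))// /T; lra.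
Qed.

End ties.

(** * The first time at which many true columns are touched *)

Section finite_families.
Variable R : realType.

Lemma continuous_bigsum (I : finType) (Q : pred I) (h : I -> R -> R) :
  (forall i, continuous (h i)) -> continuous (fun t => \sum_(i | Q i) h i t).
Proof.
move=> hc t; have FF := @nbhs_filter _ t.
by apply: (cvg_big add_continuous) => i _; exact: hc.
Qed.

Lemma continuous_bigprod (I : finType) (Q : pred I) (h : I -> R -> R) :
  (forall i, continuous (h i)) -> continuous (fun t => \prod_(i | Q i) h i t).
Proof.
move=> hc t; have FF := @nbhs_filter _ t.
by apply: (cvg_big mul_continuous) => i _; exact: hc.
Qed.

Lemma measurable_bigsum d (T : measurableType d) (I : finType) (Q : pred I)
    (h : I -> T -> R) :
  (forall i, Q i -> measurable_fun setT (h i)) ->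
  measurable_fun setT (fun w => \sum_(i | Q i) h i w).
Proof.
move=> mh; under eq_fun do rewrite big_mkcond.
apply: (@measurable_sum _ _ _ _ _ _ (fun i w => if Q i then h i w else 0)) => i.
by case: (boolP (Q i)) => Qi; [exact: mh|exact: measurable_cst].
Qed.

Lemma measurable_bigprod d (T : measurableType d) (I : finType) (Q : pred I)
    (h : I -> T -> R) :
  (forall i, Q i -> measurable_fun setT (h i)) ->
  measurable_fun setT (fun w => \prod_(i | Q i) h i w).
Proof.
move=> mh; elim: (index_enum I) => [|i r IH].
  by under eq_fun do rewrite big_nil; exact: measurable_cst.
under eq_fun do rewrite big_cons.
by case: (boolP (Q i)) => Qi //; apply: measurable_funM => //; exact: mh.
Qed.

End finite_families.

Section first_passage_probability.
Context d (Omega : measurableType d) (R : realType) (P : probability Omega R).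
Variables (n p : nat) (sigma : R).
Variables (X : 'I_n -> 'I_p -> {RV P >-> R}) (z : 'I_n -> {RV P >-> R}).
Variable beta : 'cV[R]_p.
Hypothesis model : gaussian_linear_model sigma X z.
Hypothesis n_gt0 : (0 < n)%N.
Local Notation entry := (linear_model_entries X z).
Local Notation S := [set j | beta j 0 != 0]%SET.
Local Notation u := (residual_path X z beta).
Local Notation x := (random_column X).

Definition columns_only (K : {set 'I_p}) : {set 'I_n * 'I_p + 'I_n} :=
  [set t | if t is inl ij then ij.2 \in K else false].

Lemma measurable_columns_only_coord (K : {set 'I_p}) i j : j \in K ->
  measurable_fun setT ((fun w => x j w i 0) : block entry (columns_only K) -> R).
Proof.
move=> jK; rewrite (_ : (fun w => _) = entry (inl (i, j))); last first.
  by apply/funext => w; rewrite !mxE.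
by apply: measurable_block_coord; rewrite inE.
Qed.

Definition small_correlations (K : {set 'I_p}) (v : 'cV[R]_n) : set Omega :=
  [set w | forall j, j \in K -> `|dot (x j w) v| <= 1].

Lemma small_correlationsE (K : {set 'I_p}) v : small_correlations K v =
  \bigcap_(j in [set` K]) [set w | `|dot (x j w) v| <= 1].
Proof. by apply/seteqP; split => w h j; exact: h. Qed.

Lemma measurable_small_correlations (K : {set 'I_p}) v :
  measurable (small_correlations K v : set (block entry (columns_only K))).
Proof.
rewrite small_correlationsE; apply: fin_bigcap_measurable; first exact: finite_finset.
move=> j /= jK; apply: measurable_set_ler => //; apply: measurableT_comp => //.
apply: measurable_dot => i; last exact: measurable_cst.
exact: measurable_columns_only_coord.
Qed.

(** A lower bound on the probability that a normal variable of standard deviation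
    1 / t exceeds 1. *)
Definition tail_weight (t : R) : R := normal_peak 1 * expR (- (t + 1) ^+ 2 / 2).

Lemma tail_weight_le1 t : tail_weight t <= 1.
Proof.
rewrite /tail_weight -[leRHS]mulr1 ler_pM ?normal_peak_ge0 ?expR_ge0//.
  by rewrite (le_trans (normal_peak_le _))// invr1.
rewrite -expR0 ler_expR mulNr oppr_le0.
by rewrite divr_ge0 ?sqr_ge0.
Qed.

(** The columns in K are independent, and each correlation with v stays below 1
    with probability at most one minus the tail weight. *)
Lemma small_correlations_le (K : {set 'I_p}) (v : 'cV[R]_n) (c : R) :
  0 < c -> c <= sqn v ->
  (P (small_correlations K v) <= ((1 - tail_weight (Num.sqrt (n%:R / c))) ^+ #|K|)%:E)%E.
Proof.
move=> c0 cv; have n0 : 0 < n%:R :> R by rewrite ltr0n.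
set q := tail_weight _.
have q1 : 0 <= 1 - q by rewrite subr_ge0 tail_weight_le1.
have v0 : 0 < sqn v by exact: lt_le_trans cv.
have one j : (P [set w | (`|dot (x j w) v| <= 1)%R] <= (1 - q)%:E)%E.
  have s0 : 0 < Num.sqrt (sqn v / n%:R) by rewrite sqrtr_gt0 divr_gt0.
  apply: (le_trans (gaussian_tail_lower s0 _ (gaussian_law_dot_column model v j))).
    apply: measurable_dot => i; last exact: measurable_cst.
    apply: (@measurable_block_fun _ _ _ P _ entry (column_indices n j)).
    exact: measurable_single_column_coord.
  rewrite lee_fin lerD2l lerN2 /q /tail_weight ler_wpM2l ?normal_peak_ge0//.
  rewrite ler_expR !mulNr lerN2 ler_wpM2r// ler_sqr ?nnegrE ?addr_ge0 ?sqrtr_ge0//.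
  by rewrite lerD2r -sqrtrV ?divr_ge0 ?(ltW v0)// invf_div ler_wsqrtr//
       ler_wpM2l ?(ltW n0)// lef_pV2.
move: {2}#|K| (erefl #|K|) => m; elim: m K => [|m IH] K Km.
  rewrite Km expr0; apply: probability_le1.
  apply: (@measurable_block _ _ _ P _ entry (columns_only K)).
  exact: measurable_small_correlations.
have [K0|[j jK]] := set_0Vmem K; first by rewrite K0 cards0 in Km.
have cK : #|(K :\ j)%SET| = m by move: Km; rewrite (cardsD1 j) jK => -[].
have mj : measurable ([set w | `|dot (x j w) v| <= 1] :
    set (block entry (column_indices n j))).
  apply: measurable_set_ler => //; apply: measurableT_comp => //.
  apply: measurable_dot => i; last exact: measurable_cst.
  exact: measurable_single_column_coord.
rewrite (_ : small_correlations K v = small_correlations (K :\ j)%SET v `&`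
    [set w | `|dot (x j w) v| <= 1]); last first.
  apply/seteqP; split => w h.
    by split => [k|]; rewrite ?inE; [case/andP => _ /h|exact: h].
  move: h => [h1 h2] k kK; have [->//|kj] := eqVneq k j.
  by apply: h1; rewrite !inE kj.
have disj t : t \in columns_only (K :\ j)%SET -> t \notin column_indices n j.
  rewrite inE; case: t => [[i k]|i]//=; rewrite !inE => /andP[kj _].
  by apply/negP => /imsetP[i' _ [_ E]]; rewrite E eqxx in kj.
have mK : measurable (small_correlations (K :\ j)%SET v :
    set (block entry (columns_only (K :\ j)%SET))).
  exact: measurable_small_correlations.
rewrite (block_indep (entry_indep model) disj mK mj).
rewrite Km exprSr EFinM; apply: lee_pmul => //.
by rewrite -cK; exact: IH.
Qed.

Variables (s : nat) (eta : R).
Hypotheses (s_gt0 : (0 < s)%N) (eta_gt0 : 0 < eta).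

(** A continuous function of the time that vanishes exactly when s true columns
    are touched: a product over the candidate sets of columns of the defects of
    touching. *)
Definition touch_gap (w : Omega) (t : R) : R :=
  \prod_(A : {set 'I_p} | (A \subset S) && (#|A| == s))
    \sum_(j in A) `| `|dot (x j w) (u t w)| - 1|.

(** The two sample points separate the roles of the true columns with the noise,
    through w, and of the false columns, through w'. The excess is nonpositive
    exactly when no false column has a correlation above 1. *)
Definition excess (w w' : Omega) (t : R) : R :=
  \sum_(j in ~: S) Num.max 0 (`|dot (x j w') (u t w)| - 1).

Lemma continuous_touch_gap w : continuous (touch_gap w).
Proof.
apply: continuous_bigprod => A; apply: continuous_bigsum => j t.
have h : continuous (fun t => dot (x j w) (u t w)) by exact: continuous_dot_residual.
have h1 : continuous (fun t => `|dot (x j w) (u t w)| - 1).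
  move=> t'; apply: cvgB; last exact: cvg_cst.
  exact: (cvg_comp _ _ (h t') (@norm_continuous _ R^o _)).
exact: (cvg_comp _ _ (h1 t) (@norm_continuous _ R^o _)).
Qed.

Lemma continuous_excess w w' : continuous (excess w w').
Proof.
apply: continuous_bigsum => j t.
have h : continuous (fun t => dot (x j w') (u t w)) by exact: continuous_dot_residual.
have h1 : continuous (fun t => `|dot (x j w') (u t w)| - 1).
  move=> t'; apply: cvgB; last exact: cvg_cst.
  exact: (cvg_comp _ _ (h t') (@norm_continuous _ R^o _)).
exact: (@continuous_max R R (fun=> 0) _ t (@cst_continuous _ _ 0 t) (h1 t)).
Qed.

Lemma excess_le0 w w' t :
  excess w w' t <= 0 <-> small_correlations (~: S)%SET (u t w) w'.
Proof.
have ge0 j : 0 <= Num.max 0 (`|dot (x j w') (u t w)| - 1) by rewrite le_max lexx.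
split => [h j jS|h]; last first.
  rewrite /excess big1// => j jS; apply/max_idPl.
  by rewrite subr_le0; exact: h.
have : excess w w' t == 0 by rewrite eq_le h sumr_ge0.
rewrite psumr_eq0// => /allP/(_ j (mem_index_enum j)); rewrite jS /= => /eqP/max_idPl.
by rewrite subr_le0.
Qed.

Lemma touch_gap_eq0 w t : touch_gap w t = 0 <->
  exists A : {set 'I_p}, [/\ A \subset S, #|A| = s &
    forall j, j \in A -> `|dot (x j w) (u t w)| = 1].
Proof.
split => [/eqP|[A [AS As touch]]].
  rewrite prodf_seq_eq0 => /hasP[A _ /andP[/andP[AS /eqP As]]].
  rewrite psumr_eq0// => /allP h; exists A; split => // j jA.
  have := h j (mem_index_enum j); rewrite jA /= normr_eq0 subr_eq0.
  by move=> /eqP.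
rewrite /touch_gap (bigD1 A)/=; last by rewrite AS As eqxx.
by rewrite big1 ?mul0r// => j /touch ->; rewrite subrr normr0.
Qed.

(** At time 0, that is, for an infinite penalty, the response of the normalized
    problem vanishes. Hence no column is touched at time 0. *)
Lemma residual_path0 w : u 0 w = 0.
Proof.
rewrite /residual_path scale0r.
set M := mask_columns _ _.
have h0 : lasso_argmin M 0 1 0.
  apply/lasso_argminP => // c; rewrite mulmx0 subr0 dot0l mul1r.
  rewrite (_ : l1norm 0 = 0) ?subr0 ?l1norm_ge0//.
  by rewrite /l1norm big1// => j _; rewrite mxE normr0.
have := lasso_residual_unique ler01 (lassoP M 0 ltr01) h0.
by rewrite mulmx0 subr0.
Qed.

Lemma touch_gap0 w : touch_gap w 0 != 0.
Proof.
apply/eqP => /touch_gap_eq0[A [_ As touch]].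
have [A0|[j jA]] := set_0Vmem A; first by move: s_gt0; rewrite -As A0 cards0.
have := touch j jA; rewrite residual_path0 dotC dot0l normr0 => /esym/eqP.
by rewrite oner_eq0.
Qed.

Local Notation U := (block entry (columns_and_noise n S)).
Local Notation F' := (block entry (columns_only (~: S)%SET)).

Lemma measurable_touch_gap t :
  measurable_fun setT ((fun w => touch_gap w t) : U -> R).
Proof.
apply: measurable_bigprod => A /andP[AS _]; apply: measurable_bigsum => j jA.
apply: measurableT_comp => //; apply: measurable_funB => //.
apply: measurableT_comp => //; apply: measurable_dot_path => //.
exact: (fintype.subsetP AS).
Qed.

Lemma measurable_excess t :
  measurable_fun setT ((fun y => excess y.1 y.2 t) : (U * F')%type -> R).
Proof.
apply: measurable_bigsum => j jS; apply: measurable_maxr => //.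
apply: measurable_funB => //; apply: measurableT_comp => //.
apply: measurable_dot => i.
  have h : measurable_fun setT ((fun w => x j w i 0) : F' -> R).
    exact: measurable_columns_only_coord.
  exact: (measurableT_comp h measurable_snd).
have h : measurable_fun setT ((fun w => u t w i 0) : U -> R).
  exact: measurable_residual_path.
exact: (measurableT_comp h measurable_fst).
Qed.

(** Some set of s true columns is touched before a false column exceeds 1. *)
Definition early_touch : set (U * F') :=
  [set y | exists K, forall k, exists q,
    rational_passage (touch_gap y.1) (excess y.1 y.2) K k q].

Lemma measurable_early_touch : measurable early_touch.
Proof.
rewrite (_ : early_touch = \bigcup_K \bigcap_k \bigcup_q
    [set y | rational_passage (touch_gap y.1) (excess y.1 y.2) K k q]); last first.
  apply/seteqP; split => y.
    by move=> [K hK]; exists K => // k _; have [q hq] := hK k; exists q.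
  by move=> [K _ hK]; exists K => k; have [q _ hq] := hK k I; exists q.
apply: bigcupT_measurable => K; apply: bigcapT_measurable => k.
apply: bigcupT_measurable_rat => q.
have cst_set (C : Prop) : measurable [set y : U * F' | C].
  have [hC|hC] := pselect C.
    by rewrite (_ : [set y | C] = setT)//; apply/seteqP; split.
  by rewrite (_ : [set y | C] = set0)//; apply/seteqP; split.
rewrite (_ : [set y | _] = [set y : U * F' | 0 < (ratr q : R) <= K%:R] `&`
   ([set y | `|touch_gap y.1 (ratr q)| < k.+1%:R^-1] `&`
   \bigcap_(q' in [set q' | 0 < (ratr q' : R) <= ratr q])
     [set y | excess y.1 y.2 (ratr q') <= 0])); last first.
  apply/seteqP; split => y /=.
    by move=> [h1 h2 h3]; split => //; split => // q'; exact: h3.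
  by move=> [h1 [h2 h3]]; split => // q'; exact: h3.
apply: measurableI => //; apply: measurableI.
  apply: measurable_set_ltr => //; apply: measurableT_comp => //.
  exact: (measurableT_comp (measurable_touch_gap _) measurable_fst).
rewrite -[X in measurable X]setCK setC_bigcap; apply: measurableC.
rewrite bigcup_mkcond; apply: bigcupT_measurable_rat => q'.
case: ifP => // _; apply: measurableC; apply: measurable_set_ler => //.
exact: measurable_excess.
Qed.

(** Given the true columns and the noise, the first time t1 at which s true
    columns are touched is determined, and early touching requires that no
    false column exceeds 1 at t1. Evaluating the path at this single time is
    what makes the bound independent of the true coefficients. As s columns are
    touched, the residual at t1 is large by [touching_norm], and it is
    independent of the false columns. *)
Lemma early_touch_le :
  (P (~` large_signed_sum X S s eta `&` [set w | early_touch (w, w)]) <=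
   ((1 - tail_weight (Num.sqrt (n%:R / (s%:R / (1 + eta))))) ^+ #|(~: S)%SET|)%:E)%E.
Proof.
set b := (X in (_ <= X%:E)%E).
have b0 : 0 <= b by rewrite exprn_ge0// subr_ge0 tail_weight_le1.
have eta1 : 0 < 1 + eta by rewrite addr_gt0.
have c0 : 0 < s%:R / (1 + eta) by rewrite divr_gt0 ?ltr0n.
have mA : measurable (~` large_signed_sum X S s eta : set U).
  by apply: measurableC; exact: measurable_large_signed_sum_block.
have disj t : t \in columns_and_noise n S -> t \notin columns_only (~: S)%SET.
  rewrite [t \in columns_and_noise _ _]inE [t \in columns_only _]inE.
  by case: t => [[i j]|i] //= jS; rewrite finset.in_setC negbK.
apply: (le_trans (section_bound (entry_indep model) disj mA measurable_early_touch b0 _)).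
  move=> w wA.
  have [[t [t0 Ft]]|noF] := pselect (exists t, 0 < t /\ touch_gap w t = 0); last first.
    rewrite (_ : xsection early_touch w = set0) ?measure0 ?lee_fin//.
    apply/seteqP; split => w' //; rewrite /xsection/= inE => -[K hK].
    have [t t0 [Ft _]] := rational_passage_zero (@continuous_touch_gap w)
      (@continuous_excess w w') (touch_gap0 w) hK.
    by apply: noF; exists t.
  have [t1 t10 [Ft1 t1min]] := first_zero (@continuous_touch_gap w) (touch_gap0 w) t0 Ft.
  have vc : s%:R / (1 + eta) <= sqn (u t1 w).
    have [A [AS As touch]] := (touch_gap_eq0 w t1).1 Ft1.
    rewrite ler_pdivrMr//.
    rewrite mulrC; exact: (touching_norm eta_gt0 s_gt0 AS As wA touch).
  have sub : xsection early_touch w `<=` small_correlations (~: S)%SET (u t1 w).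
    move=> w'; rewrite /xsection/= inE => -[K hK].
    have [t2 t20 [Ft2 gle]] := rational_passage_zero (@continuous_touch_gap w)
      (@continuous_excess w w') (touch_gap0 w) hK.
    by apply/excess_le0/gle; rewrite t10/= t1min.
  apply: le_trans (small_correlations_le (~: S)%SET c0 vc).
  apply: le_measure => //; rewrite inE.
    apply: (@measurable_block _ _ _ P _ entry (columns_only (~: S)%SET)).
    exact: measurable_xsection measurable_early_touch.
  apply: (@measurable_block _ _ _ P _ entry (columns_only (~: S)%SET)).
  exact: measurable_small_correlations.
rewrite -[leRHS]mule1 lee_wpmul2l ?lee_fin//; apply: probability_le1.
exact: measurable_block mA.
Qed.

(** If the rank exceeds s, then by [late_first_false] more than s columns are
    touched at the time of the first false selection. All but one of them are
    true, as two false columns are not touched simultaneously; so s true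
    columns are touched before a false column exceeds 1. *)
Lemma first_false_rank_event : exists B : set Omega, [/\ measurable B,
  (P B <= (('C(p, s) * 2 ^ s)%:R * chi_square_rate eta ^+ n +
    (1 - tail_weight (Num.sqrt (n%:R / (s%:R / (1 + eta))))) ^+ #|(~: S)%SET|)%:E)%E &
  forall w, ~ B w ->
    (first_false_rank (design X w) (response X z beta w) beta <= s)%N].
Proof.
have [N [mN PN tieN]] := tie_negligible beta model n_gt0.
pose L := large_signed_sum X S s eta.
have mLU : measurable (L : set U) by exact: measurable_large_signed_sum_block.
have mL : measurable (L : set Omega) by exact: measurable_block mLU.
pose E := [set w : Omega | early_touch (w, w)].
have mE : measurable E.
  rewrite -[X in measurable X]setTI.
  apply: (@measurable_block_diagonal _ _ _ P _ entry (columns_and_noise n S)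
    (columns_only (~: S)%SET)) => //.
  exact: measurable_early_touch.
have mLE : measurable (~` L `&` E) by apply: measurableI => //; exact: measurableC.
exists (L `|` (~` L `&` E) `|` N); split.
- by do 2 apply: measurableU => //.
- apply: (@le_trans _ _ (P (L `|` (~` L `&` E)) + P N)%E).
    by apply: measureU2 => //; exact: measurableU.
  rewrite PN adde0; apply: le_trans (measureU2 _ mL mLE) _.
  rewrite EFinD; apply: leeD; last exact: early_touch_le.
  exact: (large_signed_sum_le model n_gt0).
move=> w nB; rewrite leqNgt; apply/negP => /late_first_false[tau tau0 [le1 [A touchA cardA]]].
have nL : ~ L w by move=> Lw; apply: nB; left; left.
have nE : ~ E w by move=> Ew; apply: nB; left; right; split.
have nN : ~ N w by move=> Nw; apply: nB; right.
have touch j : j \in A -> `|dot (x j w) (u tau w)| = 1.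
  by move=> jA; rewrite -(touchA j jA) trmx_mulmx_col.
have sAS : (s <= #|(A :&: S)%SET|)%N.
  move: cardA => /orP[sA|/andP[AS sA]]; last by rewrite (finset.setIidPl AS).
  rewrite -ltnS (leq_trans sA)// -(finset.cardsID S A) -[leqRHS]addn1 leq_add2l leqNgt.
  apply/negP => /card_gt1P[j [k [jD kD jk]]].
  move: jD kD; rewrite !finset.in_setD => /andP[jS jA] /andP[kS kA].
  by apply: nN; apply: (tieN j k jS kS jk); exists tau => //; split; exact: touch.
have [A' A'sub A's] : exists2 A' : {set 'I_p}, A' \subset (A :&: S)%SET & #|A'| = s.
  have /card_geqP[r [ur rs rA]] := sAS.
  exists [set j in r]%SET; last by rewrite cardsE (card_uniqP ur).
  by apply/fintype.subsetP => j; rewrite inE; exact: rA.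
have F0 : touch_gap w tau = 0.
  apply/touch_gap_eq0; exists A'; split => //.
    exact: (fintype.subset_trans A'sub (finset.subsetIr _ _)).
  move=> j jA'; apply: touch.
  by have := fintype.subsetP A'sub j jA'; rewrite finset.in_setI => /andP[].
apply: nE; rewrite /E /early_touch /=.
apply: (passage_rational (@continuous_touch_gap w) tau0 F0).
move=> t ht; apply/excess_le0 => j _.
by have := le1 t ht j; rewrite trmx_mulmx_col.
Qed.

End first_passage_probability.

(** * Convergence rates *)

Section rates.
Variable R : realType.

(** One term of the binomial expansion of (1 + x) ^ p. *)
Lemma binomial_le (p s : nat) (x : R) : 0 <= x ->
  'C(p, s)%:R * x ^+ s <= (1 + x) ^+ p.
Proof.
move=> x0; have [ps|sp] := ltnP p s.
  by rewrite bin_small// mul0r exprn_ge0// addr_ge0.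
rewrite exprDn (bigD1 (inord s : 'I_p.+1))//= inordK ?ltnS//.
rewrite expr1n mul1r mulr_natl lerDl sumr_ge0// => i _.
by rewrite expr1n mul1r mulrn_wge0// exprn_ge0.
Qed.

Lemma expr_le_expR (t : R) (N : nat) : t <= 1 -> (1 - t) ^+ N <= expR (- (t * N%:R)).
Proof.
move=> t1; rewrite -mulNr mulrC expRM_natl lerXn2r ?nnegrE ?subr_ge0 ?expR_ge0//.
exact: expR_ge1Dx.
Qed.

Lemma expRN_le (t : R) : 0 <= t -> expR (- t) <= (1 + t)^-1.
Proof.
move=> t0; rewrite expRN lef_pV2 ?posrE ?expR_gt0 ?ltr_pwDl//.
exact: expR_ge1Dx.
Qed.

(** The number of signed subsets has a logarithm of order s log (1 / x) + x p
    for every x > 0. Here s is of order n / L, hence negligible with respect to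
    n, and x is chosen such that x p is a small multiple of n: the entropy is
    absorbed by the chi-square rate. *)
Lemma selection_entropy_le (n p s : nat) (c delta r x L : R) :
  0 < c -> 0 < delta -> 0 < r -> 0 < L -> x = r * delta / 8 ->
  p%:R <= 2 / delta * n%:R -> s%:R <= n%:R / L ->
  8 / (x * r) <= L -> 4 / (c * r) <= n%:R ->
  ('C(p, s) * 2 ^ s)%:R * expR (- r) ^+ n <= c / 2.
Proof.
move=> c0 d0 r0 L0 xE pn sn Lx nc.
have x0 : 0 < x by rewrite xE divr_gt0// mulr_gt0.
have n0 : 0 <= n%:R :> R by [].
have h1 : 'C(p, s)%:R * x ^+ s <= expR (r * n%:R / 4).
  apply: (le_trans (binomial_le _ _ (ltW x0))).
  apply: (@le_trans _ _ (expR x ^+ p)).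
    by rewrite lerXn2r ?nnegrE ?addr_ge0 ?(ltW x0) ?expR_ge0// expR_ge1Dx.
  rewrite -expRM_natl ler_expR.
  have : x * p%:R <= x * (2 / delta * n%:R) by rewrite ler_wpM2l// ltW.
  have -> : x * (2 / delta * n%:R) = r * n%:R / 4 by rewrite xE; field; rewrite gt_eqF.
  by rewrite mulrC.
have h2 : (2 / x) ^+ s <= expR (r * n%:R / 4).
  apply: (@le_trans _ _ (expR (2 / x) ^+ s)).
    rewrite lerXn2r ?nnegrE ?expR_ge0 ?divr_ge0 ?(ltW x0)//.
    by apply: le_trans (expR_ge1Dx _); rewrite lerDr.
  rewrite -expRM_natl ler_expR.
  have h3 : s%:R * (2 / x) <= n%:R / L * (2 / x).
    by rewrite ler_wpM2r// divr_ge0// ltW.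
  apply: (le_trans h3).
  have -> : n%:R / L * (2 / x) = r * n%:R / 4 * (8 / (x * r) / L).
    by field; rewrite !gt_eqF.
  rewrite ler_piMr ?divr_ge0 ?mulr_ge0 ?(ltW r0)//.
  by rewrite ler_pdivrMr// mul1r.
have -> : ('C(p, s) * 2 ^ s)%:R = 'C(p, s)%:R * x ^+ s * (2 / x) ^+ s :> R.
  rewrite natrM natrX -mulrA -exprMn; congr (_ * _ ^+ _).
  by field; rewrite gt_eqF.
apply: (@le_trans _ _ (expR (r * n%:R / 4) * expR (r * n%:R / 4) * expR (- r) ^+ n)).
  rewrite ler_wpM2r ?exprn_ge0 ?expR_ge0// ler_pM//.
    by rewrite mulr_ge0// exprn_ge0// ltW.
  by rewrite exprn_ge0// divr_ge0// ltW.
rewrite -expRM_natl -!expRD.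
have -> : r * n%:R / 4 + r * n%:R / 4 + n%:R * - r = - (r * n%:R / 2) by field.
have rn0 : 0 <= r * n%:R / 2 by rewrite divr_ge0// mulr_ge0// ltW.
apply: (le_trans (expRN_le rn0)).
have h : 2 / c <= r * n%:R / 2.
  have := ler_wpM2l (ltW r0) nc.
  have -> : r * (4 / (c * r)) = 2 / c * 2 by field; rewrite !gt_eqF.
  by rewrite ler_pdivlMr.
have c2 : 0 < 2 / c by rewrite divr_gt0.
rewrite -[c / 2]invrK invf_div lef_pV2 ?posrE ?ltr_pwDl//.
by rewrite (le_trans h)// lerDr.
Qed.

(** With L = log p and s at least (1 + c/2) n / (2 L), the tail weight of a
    single column is at least a constant times exp (- (1 - c/16) L). The at
    least (1 - eps) exp L false columns thus have a diverging expected number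
    of exceedances. *)
Lemma tail_weight_rate (n p s N : nat) (c eps L : R) :
  0 < c -> c <= 1 -> eps < 1 -> 0 < L -> p%:R = expR L :> R -> (0 < s)%N ->
  (1 + c / 2) * (n%:R / (2 * L)) <= s%:R ->
  (1 - eps) * p%:R <= N%:R ->
  32 / (c ^+ 2 * ((1 - eps) * (normal_peak 1 * expR (- ((1 + 8 / c) / 2))))) <= L ->
  (1 - tail_weight (Num.sqrt (n%:R / (s%:R / (1 + c / 4))))) ^+ N <= c / 2.
Proof.
move=> c0 c1 eps1 L0 pL s0 sL NL big.
set a := n%:R / (s%:R / (1 + c / 4)).
have s0' : 0 < s%:R :> R by rewrite ltr0n.
have a0 : 0 <= a by rewrite !divr_ge0// addr_ge0// ltW// divr_gt0.
have aL : a * (1 + c / 2) <= 2 * L * (1 + c / 4).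
  have hs : (1 + c / 2) * n%:R <= s%:R * (2 * L).
    by rewrite -ler_pdivrMr ?mulr_gt0// -mulrA.
  have aE : a = n%:R * (1 + c / 4) / s%:R.
    by rewrite /a; field; rewrite gt_eqF//= gt_eqF//; lra.
  rewrite aE mulrAC ler_pdivrMr//.
  have c4 : 0 <= 1 + c / 4 by lra.
  have := ler_wpM2r c4 hs; lra.
set k1 := normal_peak 1 : R; have k10 : 0 < k1 by rewrite normal_peak_gt0.
set D := (1 + 8 / c) / 2.
have expo : (Num.sqrt a + 1) ^+ 2 / 2 <= (1 - c / 16) * L + D.
  (* The linear term of (sqrt a + 1)^2 is absorbed in a fraction c/8 of a. *)
  have cross : 2 * Num.sqrt a <= c / 8 * a + 8 / c.
    have h : 0 <= c / 8 * (Num.sqrt a - 8 / c) ^+ 2.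
      by rewrite mulr_ge0 ?sqr_ge0// divr_ge0// ltW.
    rewrite -[in leRHS](sqr_sqrtr a0).
    have E : c / 8 * (Num.sqrt a - 8 / c) ^+ 2 =
        c / 8 * Num.sqrt a ^+ 2 + 8 / c - 2 * Num.sqrt a.
      by field; rewrite gt_eqF.
    by rewrite E in h; lra.
  have main : (1 + c / 8) * a <= 2 * ((1 - c / 16) * L).
    have c2 : 0 < 1 + c / 2 by lra.
    rewrite -(ler_pM2r c2).
    apply: (@le_trans _ _ ((1 + c / 8) * (2 * L * (1 + c / 4)))).
      by rewrite -[leLHS]mulrA ler_wpM2l//; lra.
    have : 0 <= L * (c * (1 - c)) by rewrite !mulr_ge0 ?(ltW L0) ?(ltW c0)// subr_ge0.
    lra.
  by rewrite sqrrD sqr_sqrtr// mulr1 expr1n /D; move: cross main; rewrite -mulr_natl; lra.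
have e1 : 0 < 1 - eps by rewrite subr_gt0.
set K := (1 - eps) * (k1 * expR (- D)).
have K0 : 0 < K by rewrite !mulr_gt0 ?expR_gt0.
set q := tail_weight _.
have qN : K * (c / 16 * L) <= q * N%:R.
  have qe : k1 * expR (- D) * expR (- ((1 - c / 16) * L)) <= q.
    rewrite /q /tail_weight -mulrA ler_wpM2l ?(ltW k10)// -expRD ler_expR.
    by rewrite mulNr; lra.
  have ke : 0 <= k1 * expR (- D) * expR (- ((1 - c / 16) * L)).
    by rewrite !mulr_ge0 ?expR_ge0// ltW.
  have eN : 0 <= (1 - eps) * p%:R by rewrite mulr_ge0// ltW.
  apply: le_trans (ler_pM ke eN qe NL).
  have -> : k1 * expR (- D) * expR (- ((1 - c / 16) * L)) * ((1 - eps) * p%:R) =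
      K * expR (c / 16 * L).
    have -> : expR (c / 16 * L) = expR (- ((1 - c / 16) * L)) * p%:R.
      by rewrite pL -expRD; congr expR; ring.
    by rewrite /K; ring.
  rewrite ler_wpM2l ?(ltW K0)//.
  by apply: le_trans (expR_ge1Dx _); rewrite lerDr.
apply: (le_trans (expr_le_expR N (tail_weight_le1 _))).
have big' : 2 / c <= K * (c / 16 * L).
  have : 32 / (c ^+ 2 * K) <= L by [].
  rewrite ler_pdivrMr; last by rewrite mulr_gt0 ?exprn_gt0.
  by move=> h; rewrite ler_pdivrMr//; lra.
apply: (@le_trans _ _ (expR (- (2 / c)))).
  by rewrite ler_expR lerN2 (le_trans big').
have c2 : 0 < 2 / c by rewrite divr_gt0.
apply: (le_trans (expRN_le (ltW c2))).
rewrite -[c / 2]invrK invf_div lef_pV2 ?posrE ?ltr_pwDl ?(ltW c2)//.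
by rewrite lerDr.
Qed.

End rates.

Section eventual_bounds.
Variables (R : realType) (delta eps : R) (n p : nat -> nat).
Hypotheses (delta_gt0 : 0 < delta) (eps_lt1 : eps < 1).
Hypothesis n_oo : n m @[m --> \oo] --> \oo.
Hypothesis p_oo : p m @[m --> \oo] --> \oo.
Hypothesis np_delta : (n m)%:R / (p m)%:R @[m --> \oo] --> delta.

Lemma near_natr_ge (q : nat -> nat) (A : R) : q m @[m --> \oo] --> \oo ->
  \forall m \near \oo, A <= (q m)%:R.
Proof.
move=> /cvgnyPge/(_ (Num.truncn A).+1); apply: filterS => m h.
by rewrite (le_trans (ltW (truncnS_gt A)))// ler_nat.
Qed.

Lemma near_ln_ge (A : R) : \forall m \near \oo, A <= ln (p m)%:R :> R.
Proof.
have := near_natr_ge (expR A) p_oo; apply: filterS => m h.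
by rewrite -(expRK A) ler_ln ?posrE ?expR_gt0 ?(lt_le_trans (expR_gt0 A)).
Qed.

Definition rank_scale (m : nat) : R := (n m)%:R / (2 * ln (p m)%:R).

(** Rounding down loses at most 1, which is covered by the half of c that is
    given up in [tail_weight_rate]. *)
Definition rank_threshold (c : R) (m : nat) : nat :=
  Num.truncn ((1 + c) * rank_scale m).

(** As log p tends to infinity and n is comparable to p = exp (log p), the
    thresholds required by the two preceding bounds are all eventually
    exceeded. *)
Lemma eventual_rates (c : R) : 0 < c -> c <= 1 ->
  \forall m \near \oo,
    [/\ (0 < n m)%N, 0 < ln (p m)%:R :> R, (0 < rank_threshold c m)%N &
    forall N : nat, (1 - eps) * (p m)%:R <= N%:R ->
     ('C(p m, rank_threshold c m) * 2 ^ rank_threshold c m)%:R *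
       chi_square_rate (c / 4) ^+ n m +
     (1 - tail_weight (Num.sqrt ((n m)%:R / ((rank_threshold c m)%:R / (1 + c / 4))))) ^+ N
       <= c].
Proof.
move=> c0 c1; have d0 := delta_gt0; have c40 : 0 < c / 4 by rewrite divr_gt0.
have /andP[rho0 rho1] := chi_square_rate_lt1 c40.
set rho := chi_square_rate (c / 4).
pose r := - ln rho; have r0 : 0 < r by rewrite /r oppr_gt0 ln_lt0 ?rho0.
have rhoE : rho = expR (- r) by rewrite /r opprK lnK.
pose x := r * delta / 8.
pose K := (1 - eps) * (normal_peak 1 * expR (- ((1 + 8 / c) / 2))).
have np_near : \forall m \near \oo, delta / 2 < (n m)%:R / (p m)%:R.
  by apply: (cvgr_gt _ np_delta); rewrite ltr_pdivrMr//; lra.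
have H1 := near_natr_ge (4 / (c * r)) n_oo.
have H2 := near_natr_ge 1 n_oo.
have H3 := near_ln_ge 1.
have H4 := near_ln_ge (8 / (x * r)).
have H5 := near_ln_ge (32 / (c ^+ 2 * K)).
have H6 := near_ln_ge (32 / (c * delta)).
near=> m.
have npm : delta / 2 < (n m)%:R / (p m)%:R by near: m.
have n1 : 1 <= (n m)%:R :> R by near: m.
have L1 : 1 <= ln (p m)%:R :> R by near: m.
set L := ln (p m)%:R in L1 *.
have L0 : 0 < L by lra.
have n0 : 0 < (n m)%:R :> R by lra.
have p0 : 0 < (p m)%:R :> R.
  by rewrite ltNge; apply/negP => p0; move: L0; rewrite /L ln0// ltxx.
have pL : (p m)%:R = expR L :> R by rewrite /L lnK.
have pn : (p m)%:R <= 2 / delta * (n m)%:R.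
  move: npm; rewrite ltr_pdivlMr// => h.
  have E : 2 / delta * (n m)%:R = 2 * (n m)%:R / delta by rewrite mulrAC.
  by rewrite E ler_pdivlMr//; lra.
(* This bounds L / n, as n is at least a multiple of p. *)
have LL : L ^+ 2 / 4 <= (p m)%:R.
  rewrite pL (_ : L = 2%:R * (L / 2)); last by field.
  rewrite expRM_natl; apply: (@le_trans _ _ ((L / 2) ^+ 2)).
    by rewrite le_eqVlt; apply/orP; left; apply/eqP; field.
  rewrite lerXn2r ?nnegrE ?expR_ge0 ?divr_ge0 ?(ltW L0)//.
  by apply: le_trans (expR_ge1Dx _); rewrite lerDr.
have big : 1 <= c / 2 * rank_scale m.
  have h6 : 32 / (c * delta) <= L by rewrite /L; near: m.
  rewrite /rank_scale -/L mulrA ler_pdivlMr ?mulr_gt0// mul1r.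
  have h7 : 32 <= L * (c * delta) by rewrite -ler_pdivrMr ?mulr_gt0.
  have h8 : 32 * L <= c * delta * (4 * (p m)%:R).
    apply: (@le_trans _ _ (c * delta * L ^+ 2)).
      have := ler_wpM2l (ltW L0) h7; rewrite expr2; lra.
    rewrite ler_wpM2l ?mulr_ge0 ?(ltW c0) ?(ltW delta_gt0)//; lra.
  have h9 : delta * (p m)%:R <= 2 * (n m)%:R.
    by move: npm; rewrite ltr_pdivlMr//; lra.
  have := ler_wpM2l (ltW c0) h9; lra.
have rs0 : 0 < rank_scale m by rewrite /rank_scale divr_gt0// mulr_gt0.
have /andP[s1 s2] : (rank_threshold c m)%:R <= (1 + c) * rank_scale m <
    (rank_threshold c m).+1%:R.
  by apply: truncn_itv; rewrite mulr_ge0 ?(ltW rs0)//; lra.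
rewrite -natr1 in s2.
have sL : (1 + c / 2) * rank_scale m <= (rank_threshold c m)%:R by lra.
have spos : (0 < rank_threshold c m)%N.
  by rewrite -(ltr_nat R) (lt_le_trans _ sL)// mulr_gt0//; lra.
split => //; first by rewrite -(ltr_nat R).
move=> N hN; rewrite [leRHS](_ : c = c / 2 + c / 2); last by field.
apply: lerD.
  rewrite rhoE; apply: (@selection_entropy_le _ _ _ _ c delta r x L) => //.
  - apply: (le_trans s1); rewrite /rank_scale -/L.
    have -> : (1 + c) * ((n m)%:R / (2 * L)) = (1 + c) / 2 * ((n m)%:R / L).
      by field; rewrite gt_eqF.
    by rewrite ler_piMl ?divr_ge0 ?(ltW n0) ?(ltW L0)//; lra.
  - by rewrite /L; near: m; exact: H4.
  - by near: m; exact: H1.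
apply: (@tail_weight_rate _ _ (p m) _ _ c eps L) => //.
by rewrite /L; near: m; exact: H5.
Unshelve. all: by end_near. Qed.

End eventual_bounds.

(** * The vanishing relative error *)

Section slowest_majorant.
Context d (Omega : measurableType d) (R : realType) (P : probability Omega R).
Variables (T : Omega -> nat) (a : R).

(** The accuracy 1 / (l + 1) serves both as the relative error and as the
    probability of failure. *)
Definition bounded_within (l : nat) : Prop :=
  exists B : set Omega, [/\ measurable B, (P B <= (l.+1%:R^-1)%:E)%E &
    forall w, ~ B w -> (T w)%:R <= (1 + l.+1%:R^-1) * a].

(** The random error is built with the best accuracy L <= m that is available:
    it equals 1 / (L + 1) outside the exceptional event, and on this event it
    is so large that the deterministic bound M suffices. This performs the
    diagonal extraction over l. *)
Lemma slowest_majorant (M m : nat) : 0 < a -> (forall w, (T w <= M)%N) ->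
  exists r : {RV P >-> R},
    (forall l, (l <= m)%N -> bounded_within l -> forall h : R, l.+1%:R^-1 < h ->
      (P [set w | (h <= `|r w|)%R] <= (l.+1%:R^-1)%:E)%E) /\
    ((exists2 l, (l <= m)%N & bounded_within l) ->
      forall w, (T w)%:R <= (1 + r w) * a).
Proof.
move=> a0 TM.
have [ex|nex] := pselect (exists2 l, (l <= m)%N & bounded_within l); last first.
  exists (cst 0); split => [l lm bl|]; first by exfalso; apply: nex; exists l.
  by move=> ex; exfalso.
pose Q := fun l => (l <= m)%N && `[< bounded_within l >].
have exQ : exists l, Q l by case: ex => l lm bl; exists l; rewrite /Q lm; exact/asboolP.
have ubQ l : Q l -> (l <= m)%N by case/andP.
have [L /andP[Lm /asboolP[B [mB PB TB]]] Lmax] := ex_maxnP exQ ubQ.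
pose K : R := M%:R / a.
have K0 : 0 <= K by rewrite divr_ge0// ltW.
pose r0 := fun w => L.+1%:R^-1 + K * \1_B w : R.
have mr : measurable_fun setT r0.
  by apply: measurable_funD => //; apply: measurable_funM.
pose r : {mfun Omega >-> R} := HB.pack r0 (isMeasurableFun.Build _ _ _ _ r0 mr).
have r0_ge0 w : 0 <= r0 w by rewrite addr_ge0// mulr_ge0.
exists r; split=> [l lm bl h lh|_ w].
  have lL : (l <= L)%N by apply: Lmax; rewrite /Q lm; exact/asboolP.
  have LlV : L.+1%:R^-1 <= l.+1%:R^-1 :> R by rewrite lef_pV2 ?posrE// ler_nat ltnS.
  apply: (@le_trans _ _ (P B)); last by rewrite (le_trans PB)// lee_fin.
  apply: le_measure; rewrite ?inE//.
    by apply: measurable_set_ler => //; exact: measurableT_comp.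
  move=> w /= hr; apply: contrapT => wB.
  move: hr; rewrite ger0_norm//= /r0 indicE memNset// mulr0 addr0 => hr.
  by have := lt_le_trans lh (le_trans hr LlV); rewrite ltxx.
have [wB|wB] := pselect (B w); last first.
  by rewrite /= /r0 indicE memNset// mulr0 addr0; exact: TB.
rewrite /= /r0 indicE mem_set// mulr1.
apply: (@le_trans _ _ (K * a)); first by rewrite divfK ?gt_eqF// ler_nat.
rewrite ler_wpM2r ?(ltW a0)// addrA lerDr addr_ge0//.
Qed.

End slowest_majorant.

Theorem theorem4 (R : realType) (delta sigma eps : R) (n p : nat -> nat)
    (d : nat -> measure_display) (Omega : forall m, measurableType (d m))
    (P : forall m, probability (Omega m) R)
    (X : forall m, 'I_(n m) -> 'I_(p m) -> {RV (P m) >-> R})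
    (z : forall m, 'I_(n m) -> {RV (P m) >-> R})
    (beta : forall m, 'cV[R]_(p m))
    (delta_gt0 : 0 < delta) (sigma_ge0 : 0 <= sigma)
    (eps_gt0 : 0 < eps) (eps_lt1 : eps < 1)
    (n_oo : n m @[m --> \oo] --> \oo) (p_oo : p m @[m --> \oo] --> \oo)
    (np_delta : (n m)%:R / (p m)%:R @[m --> \oo] --> delta)
    (model : forall m, gaussian_linear_model sigma (X m) (z m))
    (sparsity : forall m, (support_size (beta m))%:R <= eps * (p m)%:R) :
  exists2 r : forall m, {RV (P m) >-> R},
    vanishes_in_probability r &
    \forall m \near \oo, forall w : Omega m,
      (first_false_rank (design (X m) w) (response (X m) (z m) (beta m) w)
         (beta m))%:R
      <= (1 + r m w) * ((n m)%:R / (2 * ln (p m)%:R)).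
Proof.
pose T m w := first_false_rank (design (X m) w) (response (X m) (z m) (beta m) w) (beta m).
have false_count m : (1 - eps) * (p m)%:R <= #|(~: [set j | beta m j 0 != 0])%SET|%:R.
  have := sparsity m; rewrite support_sizeE => sp.
  have := cardsC [set j | beta m j 0 != 0]%SET; rewrite card_ord.
  move=> /(congr1 (fun k : nat => k%:R : R)); rewrite natrD => h.
  by rewrite -h in sp *; lra.
have eventually_bounded l : \forall m \near \oo,
    0 < rank_scale R n p m /\ bounded_within (P m) (@T m) (rank_scale R n p m) l.
  have c0 : 0 < l.+1%:R^-1 :> R by rewrite invr_gt0.
  have c1 : l.+1%:R^-1 <= 1 :> R by rewrite invf_le1 ?ler1n.
  have := eventual_rates delta_gt0 eps_lt1 n_oo p_oo np_delta c0 c1.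
  apply: filterS => m [n0 L0 s0 rate]; set c := l.+1%:R^-1 in c0 c1 rate.
  have a0 : 0 < rank_scale R n p m by rewrite divr_gt0 ?ltr0n// mulr_gt0.
  split => //.
  have c40 : 0 < c / 4 by rewrite divr_gt0.
  have [B [mB PB TB]] := first_false_rank_event (beta m) (model m) n0 s0 c40.
  exists B; split => //.
    by apply: (le_trans PB); rewrite lee_fin; exact: rate (false_count m).
  move=> w wB; apply: (@le_trans _ _ (rank_threshold n p (c : R) m)%:R).
    by rewrite ler_nat; exact: TB.
  rewrite /rank_threshold.
  have h : 0 <= (1 + c) * rank_scale R n p m by rewrite mulr_ge0 ?(ltW a0)//; lra.
  by have /andP[] := truncn_itv h.
have majorant m : exists r : {RV (P m) >-> R}, 0 < rank_scale R n p m ->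
    (forall l, (l <= m)%N -> bounded_within (P m) (@T m) (rank_scale R n p m) l ->
      forall h : R, l.+1%:R^-1 < h ->
      (P m [set w | (h <= `|r w|)%R] <= (l.+1%:R^-1)%:E)%E) /\
    ((exists2 l, (l <= m)%N & bounded_within (P m) (@T m) (rank_scale R n p m) l) ->
      forall w, (T m w)%:R <= (1 + r w) * rank_scale R n p m).
  have [a0|a0] := pselect (0 < rank_scale R n p m); last by exists (cst 0).
  have [r hr] := @slowest_majorant _ _ R (P m) (T m) _ (p m).+1 m a0
    (fun w => first_false_rank_le _ _ _).
  by exists r => _; exact: hr.
pose r m := projT1 (cid (majorant m)).
have rP m := projT2 (cid (majorant m)).
exists r; last first.
  have := eventually_bounded 0%N; apply: filterS => m [a0 b0] w.
  by apply: (rP m a0).2; exists 0%N.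
move=> eta eta0.
have meas m : measurable [set w | eta <= `|r m w|].
  by apply: measurable_set_ler => //; exact: measurableT_comp.
rewrite (_ : (fun m => _) = (fun m => (fine (P m [set w | eta <= `|r m w|]))%:E)); last first.
  by apply/funext => m; rewrite fineK// fin_num_measure.
apply: cvg_EFin; first by apply: nearW.
apply/cvgrPdist_le => /= e e0.
have [l hl] : exists l, l.+1%:R^-1 < Num.min eta e.
  have me : 0 < Num.min eta e by rewrite lt_min eta0.
  by have [l] := ltr_add_invr me; rewrite add0r => ?; exists l.
move: hl; rewrite lt_min => /andP[leta le].
have near_l : \forall m \near \oo, (l <= m)%N by exact: nbhs_infty_ge.
have := eventually_bounded l; apply: filterS2 near_l => m lm [a0 bl].
rewrite sub0r normrN ger0_norm ?fine_ge0//.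
apply: (le_trans _ (ltW le)).
by rewrite -lee_fin fineK ?fin_num_measure//; exact: (rP m a0).1 l lm bl eta leta.
Qed.
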